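(* Let $(M^{4n+3},\phi_\alpha,\xi_\alpha,\eta_\alpha,g)$ be a $3$-cosymplectic manifold. Suppose that each point of $M^{4n+3}$ admits a Darboux coordinate system $\{x_1,\ldots,x_n,y_1,\ldots,y_n,u_1,\ldots,u_n,v_1,\ldots,v_n,z_1,z_2,z_3\}$ in a neighbourhood of it such that $$\Phi_1=-2\sum_{i=1}^n(dx_i\wedge dy_i+du_i\wedge dv_i)-2\,dz_2\wedge dz_3,$$ $$\Phi_2=-2\sum_{i=1}^n(dx_i\wedge du_i-dy_i\wedge dv_i)+2\,dz_1\wedge dz_3,$$ $$\Phi_3=-2\sum_{i=1}^n(dx_i\wedge dv_i+dy_i\wedge du_i)-2\,dz_1\wedge dz_2.$$ Then $M^{4n+3}$ is flat, i.e. the Riemann curvature tensor of $g$ vanishes identically.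
   Context: An almost contact structure on an odd-dimensional manifold $M$ is a triple $(\phi,\xi,\eta)$ with $\phi$ a $(1,1)$-tensor field, $\xi$ a vector field, $\eta$ a $1$-form, such that $\phi^2=-I+\eta\otimes\xi$, $\eta(\xi)=1$. It is normal if $[\phi,\phi]+2d\eta\otimes\xi=0$, where $[\phi,\phi]$ is the Nijenhuis tensor of $\phi$. A Riemannian metric $g$ is compatible if $g(\phi E,\phi F)=g(E,F)-\eta(E)\eta(F)$; then the fundamental $2$-form is $\Phi(E,F)=g(E,\phi F)$. An almost $3$-contact metric manifold is a $(4n+3)$-dimensional smooth manifold with three almost contact structures $(\phi_\alpha,\xi_\alpha,\eta_\alpha)$, $\alpha\in\{1,2,3\}$, and a Riemannian metric $g$ compatible with each of them, such that for all $\alpha,\beta$: $\phi_\alpha\phi_\beta-\eta_\beta\otimes\xi_\alpha=\sum_\gamma\epsilon_{\alpha\beta\gamma}\phi_\gamma-\delta_{\alpha\beta}I$, $\phi_\alpha\xi_\beta=\sum_\gamma\epsilon_{\alpha\beta\gamma}\xi_\gamma$, $\eta_\alpha\circ\phi_\beta=\sum_\gamma\epsilon_{\alpha\beta\gamma}\eta_\gamma$, where $\epsilon_{\alpha\beta\gamma}$ is the totally antisymmetric symbol. It is $3$-cosymplectic if for each $\alpha$ one has $d\eta_\alpha=0$, $d\Phi_\alpha=0$ and the structure $(\phi_\alpha,\xi_\alpha,\eta_\alpha)$ is normal. A Darboux coordinate system is a system of $4n+3$ local coordinates, the last three being $z_1,z_2,z_3$, with respect to which each $\Phi_\alpha$ has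 constant components and each $\xi_\alpha$ is of the form $\sum_{\beta=1}^3a_\alpha^\beta\frac{\partial}{\partial z_\beta}$ with functions $a_\alpha^\beta$ depending only on $z_1,z_2,z_3$. Conventions: $(\omega\wedge\theta)(E,F)=\frac12(\omega(E)\theta(F)-\omega(F)\theta(E))$ for $1$-forms, and $2d\eta(E,F)=E(\eta(F))-F(\eta(E))-\eta([E,F])$. *)

(* Defs.v *)
From HB Require Import structures.
From mathcomp Require Import all_boot all_order all_algebra.
From mathcomp Require Import all_classical all_reals all_analysis.

Set Implicit Arguments.
Unset Strict Implicit.
Unset Printing Implicit Defensive.

Import Order.TTheory GRing.Theory Num.Theory.
Import numFieldNormedType.Exports.
Local Open Scope classical_set_scope.
Local Open Scope ring_scope.

Fixpoint Ck_on (R : realType) (m k : nat) (O : set 'rV[R]_m)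
    (f : 'rV[R]_m -> R) : Prop :=
  (forall x, O x -> {for x, continuous f}) /\
  match k with
  | 0 => True
  | k'.+1 => forall i : 'I_m,
      (forall x, O x -> derivable f x (delta_mx 0 i)) /\
      Ck_on k' O (fun x => 'D_(delta_mx 0 i) f x)
  end.

Definition Cinf_on (R : realType) (m : nat) (O : set 'rV[R]_m)
    (f : 'rV[R]_m -> R) : Prop := forall k, Ck_on k O f.

(** The coordinate map and its inverse are total functions; their values are
    meaningful only on [chart_dom] and on its image respectively. *)
Record chart (R : realType) (m : nat) (M : topologicalType) := Chart {
  chart_dom : set M;
  chart_coord : M -> 'rV[R]_m;
  chart_param : 'rV[R]_m -> M;
  chart_dom_open : open chart_dom;
  chart_im_open : open (chart_coord @` chart_dom);
  chart_coordK : forall p, chart_dom p -> chart_param (chart_coord p) = p;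
  chart_coord_cont : forall p, chart_dom p -> {for p, continuous chart_coord};
  chart_param_cont : forall x, (chart_coord @` chart_dom) x ->
    {for x, continuous chart_param}
}.

Definition smooth_transition (R : realType) (m : nat) (M : topologicalType)
    (c c' : chart R m M) : Prop :=
  forall i : 'I_m,
    Cinf_on (chart_coord c @` (chart_dom c `&` chart_dom c'))
            (fun x => chart_coord c' (chart_param c x) 0 i).

Definition chart_compatible (R : realType) (m : nat) (M : topologicalType)
    (c c' : chart R m M) : Prop :=
  smooth_transition c c' /\ smooth_transition c' c.

(** [atlas] is a maximal smooth atlas, so a local coordinate system is an
    element of [atlas].  The map [chart_at] chooses a chart around each point;
    it is only used to represent tangent vectors (see below). *)
Record smooth_manifold (R : realType) (m : nat) := SmoothManifold {
  carrier :> topologicalType;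
  manifold_hausdorff : hausdorff_space carrier;
  manifold_second_countable : @second_countable carrier;
  atlas : set (chart R m carrier);
  atlas_compatible : forall c c', atlas c -> atlas c' -> chart_compatible c c';
  atlas_maximal : forall c,
    (forall c', atlas c' -> chart_compatible c c') -> atlas c;
  chart_at : carrier -> chart R m carrier;
  chart_at_atlas : forall p, atlas (chart_at p);
  chart_at_dom : forall p, chart_dom (chart_at p) p
}.

Section Tensors.
Context {R : realType} {m : nat} {M : smooth_manifold R m}.

(** The tangent space at [p] is R^m, the row [v] standing for the vector
    [\sum_i v_i d/dx_i] where the [x_i] are the coordinates of [chart_at p].
    Hence the representation of a smooth field may jump with [p]; regularity
    is always tested through honest charts ([smooth_fun], [smooth_vfield]). *)
Definition vfield := M -> 'rV[R]_m.
Definition form1 := M -> 'rV[R]_m -> R.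
Definition form2 := M -> 'rV[R]_m -> 'rV[R]_m -> R.
Definition endo := M -> 'rV[R]_m -> 'rV[R]_m.

(** The differential of [f], i.e. the value [v(f)] of the tangent vector [v]. *)
Definition dfun (f : M -> R) : form1 := fun p v =>
  'D_v (f \o chart_param (chart_at p)) (chart_coord (chart_at p) p).

Definition vact (X : vfield) (f : M -> R) : M -> R := fun p => dfun f p (X p).

Definition coordinate (c : chart R m M) (i : 'I_m) : M -> R :=
  fun p => chart_coord c p 0 i.

(** The coordinate vector field d/dx_i of the chart [c]. *)
Definition coord_vfield (c : chart R m M) (i : 'I_m) : vfield := fun p =>
  \row_k 'D_(delta_mx 0 i) (coordinate (chart_at p) k \o chart_param c)
           (chart_coord c p).

Definition smooth_fun (U : set M) (f : M -> R) : Prop :=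
  forall c, atlas c ->
    Cinf_on (chart_coord c @` (U `&` chart_dom c)) (f \o chart_param c).

Definition smooth_vfield (U : set M) (X : vfield) : Prop :=
  forall c, atlas c -> forall i : 'I_m,
    smooth_fun (U `&` chart_dom c) (vact X (coordinate c i)).

Definition is_form1 (eta : form1) : Prop :=
  (forall p (a : R) v w, eta p (a *: v + w) = a * eta p v + eta p w) /\
  (forall U X, open U -> smooth_vfield U X ->
     smooth_fun U (fun p => eta p (X p))).

Definition is_endo (phi : endo) : Prop :=
  (forall p (a : R) v w, phi p (a *: v + w) = a *: phi p v + phi p w) /\
  (forall U X, open U -> smooth_vfield U X ->
     smooth_vfield U (fun p => phi p (X p))).

Definition is_riemannian (g : form2) : Prop :=
  [/\ forall p (a : R) u v w, g p (a *: u + v) w = a * g p u w + g p v w,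
      forall p v w, g p v w = g p w v,
      forall p v, v != 0 -> 0 < g p v v
    & forall U X Y, open U -> smooth_vfield U X -> smooth_vfield U Y ->
        smooth_fun U (fun p => g p (X p) (Y p))].

(** Components, in the coordinates of [chart_at p], of the vector field
    [X, Y] characterized by [X, Y] f = X (Y f) - Y (X f). *)
Definition bracket (X Y : vfield) : vfield := fun p =>
  \row_i (vact X (vact Y (coordinate (chart_at p) i)) p
          - vact Y (vact X (coordinate (chart_at p) i)) p).

Definition wedge (om th : form1) : form2 := fun p v w =>
  2^-1 * (om p v * th p w - om p w * th p v).

(** Exterior derivatives with the normalization 2 d eta(E, F) = ... and
    3 d Phi(E, F, G) = ..., matching the factor 1/2 in [wedge]. *)
Definition ext_d1 (eta : form1) (E F : vfield) : M -> R := fun p =>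
  2^-1 * (vact E (fun q => eta q (F q)) p - vact F (fun q => eta q (E q)) p
          - eta p (bracket E F p)).

Definition ext_d2 (Phi : form2) (E F G : vfield) : M -> R := fun p =>
  3^-1 * (vact E (fun q => Phi q (F q) (G q)) p
          + vact F (fun q => Phi q (G q) (E q)) p
          + vact G (fun q => Phi q (E q) (F q)) p
          - Phi p (bracket E F p) (G p)
          - Phi p (bracket F G p) (E p)
          - Phi p (bracket G E p) (F p)).

Definition closed_form1 (eta : form1) : Prop :=
  forall U E F, open U -> smooth_vfield U E -> smooth_vfield U F ->
    forall p, U p -> ext_d1 eta E F p = 0.

Definition closed_form2 (Phi : form2) : Prop :=
  forall U E F G, open U -> smooth_vfield U E -> smooth_vfield U F ->
    smooth_vfield U G -> forall p, U p -> ext_d2 Phi E F G p = 0.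

Definition app_endo (phi : endo) (X : vfield) : vfield := fun p => phi p (X p).

Definition nijenhuis (phi : endo) (E F : vfield) : vfield := fun p =>
  phi p (phi p (bracket E F p)) + bracket (app_endo phi E) (app_endo phi F) p
  - phi p (bracket (app_endo phi E) F p) - phi p (bracket E (app_endo phi F) p).

(** A connection acts on vector fields defined on open subsets.  As fields are
    total functions, taking [f] equal to 1 on [U] and 0 elsewhere in the
    Leibniz rules shows that its values on [U] only depend on the restrictions
    of its arguments to [U]. *)
Definition is_connection (nabla : vfield -> vfield -> vfield) : Prop :=
  forall U X X' Y Y' f, open U ->
    smooth_vfield U X -> smooth_vfield U X' ->
    smooth_vfield U Y -> smooth_vfield U Y' -> smooth_fun U f ->
    smooth_vfield U (nabla X Y) /\
    forall p, U p ->
      [/\ nabla (fun q => X q + X' q) Y p = nabla X Y p + nabla X' Y p,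
          nabla (fun q => f q *: X q) Y p = f p *: nabla X Y p,
          nabla X (fun q => Y q + Y' q) p = nabla X Y p + nabla X Y' p
        & nabla X (fun q => f q *: Y q) p =
            vact X f p *: Y p + f p *: nabla X Y p].

Definition is_levi_civita (g : form2) (nabla : vfield -> vfield -> vfield)
    : Prop :=
  is_connection nabla /\
  forall U X Y Z, open U -> smooth_vfield U X -> smooth_vfield U Y ->
    smooth_vfield U Z -> forall p, U p ->
      nabla X Y p - nabla Y X p = bracket X Y p /\
      vact X (fun q => g q (Y q) (Z q)) p =
        g p (nabla X Y p) (Z p) + g p (Y p) (nabla X Z p).

Definition curvature (nabla : vfield -> vfield -> vfield) (X Y Z : vfield)
    : vfield := fun p =>
  nabla X (nabla Y Z) p - nabla Y (nabla X Z) p - nabla (bracket X Y) Z p.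

(** By the fundamental theorem of Riemannian geometry there is, up to values
    on fields that are not smooth, exactly one [nabla] to quantify over. *)
Definition is_flat (g : form2) : Prop :=
  forall nabla, is_levi_civita g nabla ->
  forall U X Y Z, open U -> smooth_vfield U X -> smooth_vfield U Y ->
    smooth_vfield U Z -> forall p, U p -> curvature nabla X Y Z p = 0.

Definition is_almost_contact (phi : endo) (xi : vfield) (eta : form1) : Prop :=
  [/\ is_endo phi, smooth_vfield setT xi, is_form1 eta,
      forall p v, phi p (phi p v) = - v + eta p v *: xi p
    & forall p, eta p (xi p) = 1].

Definition is_normal (phi : endo) (xi : vfield) (eta : form1) : Prop :=
  forall U E F, open U -> smooth_vfield U E -> smooth_vfield U F ->
    forall p, U p ->
      nijenhuis phi E F p + (2 * ext_d1 eta E F p) *: xi p = 0.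

Definition is_compatible (phi : endo) (eta : form1) (g : form2) : Prop :=
  forall p v w, g p (phi p v) (phi p w) = g p v w - eta p v * eta p w.

Definition fundamental_form (g : form2) (phi : endo) : form2 :=
  fun p v w => g p v (phi p w).

(** The indices 1, 2, 3 are the elements 0, 1, 2 of ['I_3], on which addition
    is modulo 3. *)
Definition levi_civita_symbol (a b c : 'I_3) : R :=
  if (b == a + 1) && (c == a + 2) then 1
  else if (c == a + 1) && (b == a + 2) then -1 else 0.

End Tensors.

Arguments vfield {R m} M.
Arguments form1 {R m} M.
Arguments form2 {R m} M.
Arguments endo {R m} M.

Definition is_almost_3contact_metric (R : realType) (n : nat)
    (M : smooth_manifold R (4 * n).+3)
    (phi : 'I_3 -> endo M) (xi : 'I_3 -> vfield M) (eta : 'I_3 -> form1 M)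
    (g : form2 M) : Prop :=
  (forall a, is_almost_contact (phi a) (xi a) (eta a)) /\
  is_riemannian g /\
  (forall a, is_compatible (phi a) (eta a) g) /\
  forall a b p,
    [/\ forall v, phi a p (phi b p v) - eta b p v *: xi a p =
          \sum_(c < 3) levi_civita_symbol a b c *: phi c p v
          - (a == b)%:R *: v,
        phi a p (xi b p) =
          \sum_(c < 3) levi_civita_symbol a b c *: xi c p
      & forall v, eta a p (phi b p v) =
          \sum_(c < 3) levi_civita_symbol a b c * eta c p v].

Definition is_3cosymplectic (R : realType) (n : nat)
    (M : smooth_manifold R (4 * n).+3)
    (phi : 'I_3 -> endo M) (xi : 'I_3 -> vfield M) (eta : 'I_3 -> form1 M)
    (g : form2 M) : Prop :=
  is_almost_3contact_metric phi xi eta g /\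
  forall a, [/\ closed_form1 (eta a),
                closed_form2 (fundamental_form g (phi a))
              & is_normal (phi a) (xi a) (eta a)].

(** Positions of the coordinates (x, y, u, v, z), [i] and [b] counted from 0. *)
Definition ix (n : nat) (i : 'I_n) : 'I_((4 * n).+3) := inord i.
Definition iy (n : nat) (i : 'I_n) : 'I_((4 * n).+3) := inord (n + i).
Definition iu (n : nat) (i : 'I_n) : 'I_((4 * n).+3) := inord (2 * n + i).
Definition iv (n : nat) (i : 'I_n) : 'I_((4 * n).+3) := inord (3 * n + i).
Definition iz (n : nat) (b : 'I_3) : 'I_((4 * n).+3) := inord (4 * n + b).

Definition is_darboux (R : realType) (n : nat)
    (M : smooth_manifold R (4 * n).+3)
    (Phi : 'I_3 -> form2 M) (xi : 'I_3 -> vfield M)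
    (c : chart R (4 * n).+3 M) : Prop :=
  (forall a i j p q, chart_dom c p -> chart_dom c q ->
     Phi a p (coord_vfield c i p) (coord_vfield c j p) =
     Phi a q (coord_vfield c i q) (coord_vfield c j q)) /\
  exists A : 'I_3 -> 'I_3 -> 'rV[R]_3 -> R,
    forall a p, chart_dom c p ->
      xi a p = \sum_(b < 3)
        A a b (\row_k coordinate c (iz n k) p) *: coord_vfield c (iz n b) p.

Definition has_standard_forms (R : realType) (n : nat)
    (M : smooth_manifold R (4 * n).+3)
    (Phi : 'I_3 -> form2 M) (c : chart R (4 * n).+3 M) : Prop :=
  let dx i := dfun (coordinate c (ix i)) in
  let dy i := dfun (coordinate c (iy i)) in
  let du i := dfun (coordinate c (iu i)) in
  let dv i := dfun (coordinate c (iv i)) in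
  let dz b := dfun (coordinate c (iz n b)) in
  forall p, chart_dom c p -> forall s t,
    [/\ Phi 0 p s t =
          - 2 * (\sum_(i < n) (wedge (dx i) (dy i) p s t
                               + wedge (du i) (dv i) p s t))
          - 2 * wedge (dz 1) (dz 2) p s t,
        Phi 1 p s t =
          - 2 * (\sum_(i < n) (wedge (dx i) (du i) p s t
                               - wedge (dy i) (dv i) p s t))
          + 2 * wedge (dz 0) (dz 2) p s t
      & Phi 2 p s t =
          - 2 * (\sum_(i < n) (wedge (dx i) (dv i) p s t
                               + wedge (dy i) (du i) p s t))
          - 2 * wedge (dz 0) (dz 1) p s t].

(* Main.v *)
Require Import Defs.
From HB Require Import structures.
From mathcomp Require Import all_boot all_order all_algebra.
From mathcomp Require Import all_classical all_reals all_analysis.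
From mathcomp Require Import ring lra zify.

(** At a point of a Darboux chart, [phi_a xi_a = 0] and [eta_a(xi_a) = 1] force
    [xi_a = e d/dz_a] with a common sign [e], and the coefficients of the three
    forms then force [phi_1] to permute the remaining coordinate fields up to
    sign.  As [g(., phi_1 t) = Phi_1(., t)], the coordinate frame is
    orthonormal.  The Christoffel symbols of the chart therefore vanish, the
    Levi-Civita connection differentiates components, and the curvature
    vanishes because [[X, Y] f = X (Y f) - Y (X f)]. *)

Set Implicit Arguments.
Unset Strict Implicit.
Unset Printing Implicit Defensive.

Import Order.TTheory GRing.Theory Num.Theory.
Import numFieldNormedType.Exports.
Local Open Scope classical_set_scope.
Local Open Scope ring_scope.

(** The forms give [phi a] only through the unknown metric. What makes them usable is that all three
    are [g(., phi a .)] for the same [g]: an equality between values of two of the forms is an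
    equality between vectors [phi a t'] and [phi b t], by nondegeneracy alone. Composing through the
    quaternionic relations then determines the third endomorphism on vectors killed by every
    [eta b], and its form becomes a formula for [g] itself. Two features of the definitions shape
    the rest. Smoothness is phrased with iterated partial derivatives along the axes, whereas
    changing charts needs total differentials and a chain rule, and the bracket needs symmetric
    second derivatives; these are derived before any geometry. Moreover a tangent vector at [p] is
    written in [chart_at p], which may jump with [p], so a field is never differentiated through its
    raw components, only through its action on the coordinates of one fixed chart. *)

Local Notation e_ i := (delta_mx 0 i).

(** * Functions of class C^1 on R^m *)

Section RealVectors.
Context {R : realType}.

Lemma row_norm_le m (v : 'rV[R]_m) (c : R) :
  0 <= c -> (forall i, `|v 0 i| <= c) -> `|v| <= c.
Proof.
move=> c0 vc; rewrite [leLHS]/Num.Def.normr/= mx_normrE bigmax_le// => -[i j] _.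
by rewrite ord1.
Qed.

Lemma coord_norm_le m (v : 'rV[R]_m) i : `|v 0 i| <= `|v|.
Proof.
rewrite [leRHS]/Num.Def.normr/= mx_normrE.
exact: (le_bigmax _ (fun ij => `|v ij.1 ij.2|) (0, i)).
Qed.

(** Only the derivative of [f] along [v] is available, so the chain rule is applied in one real
    variable, to [k] and the affine change of parameter [l], which vanishes at [t]. *)
Lemma is_derive_line (V : normedModType R) (f : V -> R) (y v : V) (s t : R) :
  derivable f (y + (t * s) *: v) v ->
  is_derive t 1 (fun u : R => f (y + (u * s) *: v))
    (s * 'D_v f (y + (t * s) *: v)).
Proof.
set p := y + _ => df.
pose k (h : R) := f (h *: v + p); pose l (u : R) := (u - t) * s.
have fE : (fun u : R => f (y + (u * s) *: v)) = k \o l.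
  apply/funext => u; rewrite /k /l /p /=; congr f.
  by rewrite addrCA -scalerDl mulrBl subrK.
have lt0 : l t = 0 by rewrite /l subrr mul0r.
have dk : differentiable k (l t).
  by rewrite lt0; apply/derivable1_diffP; exact: (derivable1P f p v).1.
have dl : is_derive t 1 l s.
  have -> : l = s *: (id - cst t) by apply/funext => u; rewrite /l mulrC.
  by apply: is_derive_eq; rewrite subr0 [s *: 1]mulr1.
have dl' : differentiable l t by apply/derivable1_diffP; exact: ex_derive.
rewrite fE; apply: DeriveDef.
  by apply/derivable1_diffP; exact: differentiable_comp.
rewrite -derive1E derive1_comp ?derive1E; [|exact/derivable1_diffP..].
rewrite (derive_val (f := l)) mulrC; congr (_ * _).
rewrite lt0 /derive; do 2 f_equal; apply/funext => h /=.
by rewrite /k addr0 scale0r add0r [h *: 1]mulr1.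
Qed.

(** Rescaling the segment to [0, 1] allows [s] of either sign, or zero, without a case
    distinction. *)
Lemma MVT_line (V : normedModType R) (f : V -> R) (y v : V) (s : R) :
  (forall t : R, 0 <= t <= 1 -> derivable f (y + (t * s) *: v) v) ->
  exists2 t : R, 0 <= t <= 1 &
    f (y + s *: v) - f y = s * 'D_v f (y + (t * s) *: v).
Proof.
move=> df; pose k (u : R) := f (y + (u * s) *: v).
pose dk (u : R) := s * 'D_v f (y + (u * s) *: v).
have dfk (t : R) : 0 <= t <= 1 -> is_derive t 1 k (dk t).
  by move=> t01; apply: is_derive_line; exact: df.
have [| |c cin] := @MVT_segment R k dk 0 1 ler01.
- by move=> t; rewrite in_itv /= => /andP[t0 t1]; apply: dfk; rewrite !ltW.
- apply: derivable_within_continuous => t; rewrite in_itv /= => t01.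
  by have [] := dfk t t01.
- rewrite /k /dk mul1r mul0r scale0r addr0 subr0 mulr1 => ->.
  by exists c => //; rewrite in_itv in cin.
Qed.


(** The increment of [f] telescopes along a path from [x] to [x + h] that changes one coordinate at
    a time. On each edge the mean value theorem replaces it by a partial derivative at a point close
    to [x], and continuity at [x] concludes. *)
Lemma C1_differentiable m (O : set 'rV[R]_m) (f : 'rV[R]_m -> R) x :
  open O -> O x -> (forall i y, O y -> derivable f y (e_ i)) ->
  (forall i, {for x, continuous ('D_(e_ i) f)}) -> differentiable f x.
Proof.
move=> oO Ox df cdf.
pose L0 (v : 'rV[R]_m) : R := \sum_(i < m) v 0 i * 'D_(e_ i) f x.
have L0lin : linear L0.
  move=> a u v; rewrite /L0 scaler_sumr -big_split /=; apply: eq_bigr => i _.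
  by rewrite !mxE mulrDl -mulrA.
pose L : {linear 'rV[R]_m -> R} := HB.pack L0 (GRing.isLinear.Build _ _ _ _ _ L0lin).
have Lc : continuous L.
  move=> v; apply: (@differentiable_continuous _ _ _ v L0).
  rewrite (_ : L0 = \sum_(i < m) (fun v : 'rV[R]_m => v 0 i * 'D_(e_ i) f x)).
    apply: differentiable_sum => i; apply: differentiableM => //.
    exact: differentiable_coord.
  by apply/funext => w; rewrite fct_sumE.
suff fL : forall e, 0 < e ->
    \forall h \near (0 : 'rV[R]_m), `|f (h + x) - (f x + L h)| <= e * `|h|.
  have dL : 'd f x = L :> ('rV[R]_m -> R).
    by apply: diff_unique => //; apply/eqaddoP.
  by apply/diff_locallyP; rewrite dL; split => //; apply/eqaddoP.
move=> e e0.
(* There are [m] edges, each with this relative error; [m.+1] instead of [m] keeps the quotient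
   meaningful when [m = 0]. *)
have : \forall y \near x, O y /\
    forall i, `|'D_(e_ i) f x - 'D_(e_ i) f y| <= e / m.+1%:R.
  near=> y; split; first by near: y; exact: open_nbhs_nbhs.
  near: y; apply: filter_forall => i.
  have /cvgrPdist_le := cdf i; apply.
  by rewrite divr_gt0.
move=> /nbhs_ballP[d /= d0 xd].
near=> h.
have hd : `|h| < d.
  near: h; apply/nbhs_ballP; exists d => // z.
  by rewrite -ball_normE /= sub0r normrN.
pose t_ k : 'rV[R]_m := \row_j (if (j < k)%N then h 0 j else 0).
have tS (k : 'I_m) : t_ k.+1 = t_ k + h 0 k *: e_ k.
  apply/rowP => j; rewrite !mxE eqxx /=; case: (eqVneq j k) => [->|jk].
    by rewrite ltnSn ltnn add0r mulr1.
  by rewrite mulr0 addr0 ltnS leq_eqVlt val_eqE (negbTE jk).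
have t0 : t_ 0%N = 0 by apply/rowP => j; rewrite !mxE.
have tm : t_ m = h by apply/rowP => j; rewrite !mxE ltn_ord.
have fE : f (h + x) - f x = \sum_(k < m) (f (x + t_ k.+1) - f (x + t_ k)).
  rewrite -(big_mkord xpredT (fun k => f (x + t_ k.+1) - f (x + t_ k))).
  by rewrite telescope_sumr// t0 tm addr0 [h + x]addrC.
rewrite opprD addrA fE -sumrB.
apply: le_trans (ler_norm_sum _ _ _) _.
apply: (@le_trans _ _ (\sum_(k < m) (e / m.+1%:R * `|h|))); last first.
  rewrite sumr_const card_ord -mulrnAl ler_wpM2r// -mulr_natr -mulrA ler_piMr// ?ltW//.
  by rewrite mulrC ltr_pdivrMr ?mul1r ?ltr_nat.
apply: ler_sum => k _.
(* In the sup norm the edges stay within [|h|] of [x]: each coordinate of the displacement is 0,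
   [h 0 j] or [t * h 0 k]. *)
have dxt (t : R) : 0 <= t <= 1 -> ball x d (x + t_ k + (t * h 0 k) *: e_ k).
  move=> /andP[t0' t1]; rewrite -ball_normE /= -addrA opprD addNKr normrN.
  apply: le_lt_trans hd; apply: row_norm_le => // j; rewrite !mxE eqxx /=.
  case: (eqVneq j k) => [->|jk]; first rewrite ltnn add0r mulr1 normrM.
    by rewrite ger0_norm// (le_trans _ (coord_norm_le h k))// ler_piMl.
  rewrite mulr0 addr0; case: ifP => _; last by rewrite normr0.
  exact: coord_norm_le.
have [t t01] := @MVT_line _ f (x + t_ k) (e_ k) (h 0 k)
  (fun t t01 => df _ _ (xd _ (dxt _ t01)).1).
rewrite tS addrA => ->; rewrite -mulrBr normrM mulrC ler_pM// ?coord_norm_le//.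
by rewrite distrC; have [_] := xd _ (dxt _ t01); apply.
Unshelve. all: by end_near. Qed.

End RealVectors.

(** * Functions of class C^k on R^m *)

Section Ck.
Context {R : realType}.

Lemma derive_row_sum m (f : 'rV[R]_m -> R) (x v : 'rV[R]_m) :
  differentiable f x -> 'D_v f x = \sum_(i < m) v 0 i * 'D_(e_ i) f x.
Proof.
move=> df; rewrite {1}[v]row_sum_delta deriveE// linear_sum /=.
by apply: eq_bigr => i _; rewrite linearZ deriveE.
Qed.

Lemma differentiable_row m m' (h : 'rV[R]_m -> 'rV[R]_m') (x : 'rV[R]_m) :
  (forall i, differentiable (fun y : 'rV[R]_m => h y 0 i : R) x) ->
  differentiable h x.
Proof.
move=> dh; rewrite (_ : h = \sum_(i < m') (fun y : 'rV[R]_m => h y 0 i *: e_ i)).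
  by apply: differentiable_sum => i; exact: differentiableZl.
by apply/funext => y; rewrite fct_sumE [LHS]row_sum_delta.
Qed.

Lemma continuous_row (T : topologicalType) m (h : T -> 'rV[R]_m) (x : T) :
  (forall i, {for x, continuous (fun y => h y 0 i)}) -> {for x, continuous h}.
Proof.
move=> ch; apply/cvgrPdist_le => e e0; near=> y.
apply: row_norm_le; first exact: ltW.
move=> i; rewrite !mxE; move: i; near: y; apply: filter_forall => i.
by move/cvgrPdist_le : (ch i); apply.
Unshelve. all: by end_near. Qed.

Lemma derive_comp_row m m' (f : 'rV[R]_m' -> R) (h : 'rV[R]_m -> 'rV[R]_m')
    (x v : 'rV[R]_m) :
  differentiable f (h x) ->
  (forall i, differentiable (fun y : 'rV[R]_m => h y 0 i : R) x) ->
  'D_v (f \o h) x =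
  \sum_(i < m') 'D_v (fun y : 'rV[R]_m => h y 0 i : R) x * 'D_(e_ i) f (h x).
Proof.
move=> df /differentiable_row dh.
rewrite deriveE; last exact: differentiable_comp.
rewrite diff_comp//= -deriveE// -deriveE// derive_row_sum//.
by apply: eq_bigr => i _; rewrite derive_mx ?mxE//; exact: diff_derivable.
Qed.

Lemma continuous_at_eq (T U : topologicalType) (f g : T -> U) x :
  (\near x, f x = g x) -> {for x, continuous f} -> {for x, continuous g}.
Proof.
move=> fg cf; rewrite /prop_for /continuous_at -(nbhs_singleton fg).
exact: cvg_trans (near_eq_cvg fg) cf.
Qed.

Lemma Ck_onS m k (O : set 'rV[R]_m) f : Ck_on k.+1 O f -> Ck_on k O f.
Proof.
elim: k f => [|k IH] f; first by move=> [].
move=> [cf df]; split=> // i; split; first by case: (df i).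
by apply: IH; case: (df i).
Qed.

Lemma Ck_on_sub m k (O O' : set 'rV[R]_m) f :
  O' `<=` O -> Ck_on k O f -> Ck_on k O' f.
Proof.
move=> O'O; elim: k f => [|k IH] f [cf df]; split=> //; try by move=> x /O'O/cf.
by move=> i; have [dfi Cfi] := df i; split; [move=> x /O'O/dfi|exact: IH].
Qed.

Lemma Ck_on_eq m k (O : set 'rV[R]_m) f g :
  open O -> {in O, f =1 g} -> Ck_on k O f -> Ck_on k O g.
Proof.
move=> oO.
have nearO f' g' x : O x -> {in O, f' =1 g'} -> \forall y \near x, f' y = g' y.
  move=> Ox fg'; near=> y; apply: fg'; rewrite inE; near: y.
  exact: open_nbhs_nbhs.
elim: k f g => [|k IH] f g fg [cf df]; split=> //.
- by move=> x Ox; apply: continuous_at_eq (cf _ Ox); exact: nearO.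
- by move=> x Ox; apply: continuous_at_eq (cf _ Ox); exact: nearO.
- move=> i; have [dfi Cfi] := df i; split.
    move=> x Ox; apply: near_eq_derivable (dfi x Ox); exact: nearO.
  apply: IH Cfi => x; rewrite inE => Ox; apply: near_eq_derive.
  exact: nearO.
Unshelve. all: by end_near. Qed.

Lemma Ck_on_differentiable m k (O : set 'rV[R]_m) f x :
  open O -> O x -> Ck_on k.+1 O f -> differentiable f x.
Proof.
move=> oO Ox [_ df]; apply: (C1_differentiable oO Ox).
  by move=> i y Oy; have [+ _] := df i; apply.
by move=> i; have [_] := df i; case: k {df} => [|k] [+ _]; apply.
Qed.

Lemma Ck_on_cst m k (O : set 'rV[R]_m) (a : R) : open O -> Ck_on k O (cst a).
Proof.
move=> oO; elim: k a => [|k IH] a; split => //;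
  try by move=> x _; exact: cst_continuous.
move=> i; split; first by move=> x _; exact: derivable_cst.
by apply: Ck_on_eq (IH 0) => // x _; rewrite derive_cst.
Qed.

Lemma Ck_onD m k (O : set 'rV[R]_m) f g :
  open O -> Ck_on k O f -> Ck_on k O g -> Ck_on k O (fun x => f x + g x).
Proof.
move=> oO; elim: k f g => [|k IH] f g [cf df] [cg dg]; split=> //.
- by move=> x Ox; exact: cvgD (cf x Ox) (cg x Ox).
- by move=> x Ox; exact: cvgD (cf x Ox) (cg x Ox).
- move=> i; have [dfi Cfi] := df i; have [dgi Cgi] := dg i; split.
    by move=> x Ox; apply: derivableD; [exact: dfi|exact: dgi].
  apply: Ck_on_eq (IH _ _ Cfi Cgi) => // x; rewrite inE => Ox.
  by rewrite -deriveD//; [exact: dfi|exact: dgi].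
Qed.

Lemma Ck_onM m k (O : set 'rV[R]_m) f g :
  open O -> Ck_on k O f -> Ck_on k O g -> Ck_on k O (fun x => f x * g x).
Proof.
move=> oO; elim: k f g => [|k IH] f g.
  by move=> [cf _] [cg _]; split=> // x Ox; exact: cvgM (cf x Ox) (cg x Ox).
move=> Cf Cg; have [cf df] := Cf; have [cg dg] := Cg; split.
  by move=> x Ox; exact: cvgM (cf x Ox) (cg x Ox).
move=> i; have [dfi Cfi] := df i; have [dgi Cgi] := dg i; split.
  by move=> x Ox; apply: derivableM; [exact: dfi|exact: dgi].
have Cf' := Ck_onS Cf; have Cg' := Ck_onS Cg.
apply: Ck_on_eq (Ck_onD oO (IH _ _ Cf' Cgi) (IH _ _ Cg' Cfi)) => // x.
rewrite inE => Ox.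
exact: esym (deriveM (dfi _ Ox) (dgi _ Ox)).
Qed.

Lemma Ck_on_sum m k (O : set 'rV[R]_m) n (f : 'I_n -> 'rV[R]_m -> R) :
  open O -> (forall i, Ck_on k O (f i)) ->
  Ck_on k O (fun x => \sum_(i < n) f i x).
Proof.
move=> oO; elim: n f => [|n IH] f Cf.
  by under eq_fun do rewrite big_ord0; exact: Ck_on_cst.
by under eq_fun do rewrite big_ord_recr; apply: Ck_onD => //; exact: IH.
Qed.

(** By the chain rule, a partial derivative of [f \o h] is a sum of products of partial derivatives
    of [h] with functions ['D_(e_ j) f \o h], to which the induction hypothesis applies. *)
Lemma Ck_on_comp m m' k (O : set 'rV[R]_m) (O' : set 'rV[R]_m')
    (h : 'rV[R]_m -> 'rV[R]_m') f :
  open O -> open O' -> {homo h : x / O x >-> O' x} -> Ck_on k O' f ->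
  (forall i, Ck_on k O (fun x => h x 0 i)) -> Ck_on k O (f \o h).
Proof.
move=> oO oO' hO; elim: k f => [|k IH] f Cf Ch.
  split=> // x Ox; apply: continuous_comp; last exact: Cf.1 (hO _ Ox).
  by apply: continuous_row => i; exact: (Ch i).1.
have df x : O x -> differentiable f (h x).
  by move=> Ox; exact: Ck_on_differentiable (hO _ Ox) Cf.
have dh x i : O x -> differentiable (fun y : 'rV[R]_m => h y 0 i : R) x.
  by move=> Ox; exact: Ck_on_differentiable Ox (Ch i).
have dfh x : O x -> differentiable (f \o h) x.
  move=> Ox; apply: differentiable_comp; last exact: df.
  by apply: differentiable_row => i; exact: dh.
split=> [x Ox|i]; first exact/differentiable_continuous/dfh.
split=> [x Ox|]; first exact/diff_derivable/dfh.
pose S x := \sum_(j < m') 'D_(e_ i) (fun y : 'rV[R]_m => h y 0 j : R) x *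
                         ('D_(e_ j) f \o h) x.
apply: (@Ck_on_eq _ _ _ S) => //.
  move=> x; rewrite inE => Ox.
  by rewrite derive_comp_row//; [exact: df|move=> j; exact: dh].
apply: Ck_on_sum => // j; apply: Ck_onM => //.
  by have [_ /(_ i)[]] := Ch j.
by apply: IH; [have [_ /(_ j)[]] := Cf|move=> l; exact/Ck_onS/Ch].
Qed.

(** * Symmetry of second partial derivatives *)

Lemma derive_shift_arg (V W : normedModType R) (f : V -> W) (x v w : V) :
  'D_v (fun y => f (y + w)) x = 'D_v f (x + w).
Proof. by rewrite /derive /=; do 2 f_equal; apply/funext => h /=; rewrite addrA. Qed.

Lemma derivable_shift_arg (V W : normedModType R) (f : V -> W) (x v w : V) :
  derivable f (x + w) v -> derivable (fun y => f (y + w)) x v.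
Proof.
move=> df; rewrite /derivable [X in cvg (X @ _)](_ : _ =
  fun h => h^-1 *: ((f \o shift (x + w)) (h *: v) - f (x + w)))//.
by apply/funext => h /=; rewrite addrA.
Qed.

(** The mean value theorem is used twice: along [u] for the difference [F] of [f] and its translate
    by [s *: v], then along [v] for ['D_u f]. *)
Lemma second_difference (V : normedModType R) (f : V -> R) (x u v : V) (s : R) :
  (forall a b : R, 0 <= a <= 1 -> 0 <= b <= 1 ->
    let y := x + (a * s) *: u + (b * s) *: v in
    [/\ derivable f y u & derivable ('D_u f) y v]) ->
  exists a b : R, [/\ 0 <= a <= 1, 0 <= b <= 1 &
    f (x + s *: u + s *: v) - f (x + s *: u) - (f (x + s *: v) - f x) =
    s * (s * 'D_v ('D_u f) (x + (a * s) *: u + (b * s) *: v))].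
Proof.
move=> df; pose F := (fun y => f (y + s *: v)) - f.
have d1 (a : R) : 0 <= a <= 1 -> derivable f (x + (a * s) *: u + s *: v) u.
  move=> a01; have [|+ _] := df a 1 a01; first by rewrite ler01 lexx.
  by rewrite mul1r.
have d0 (a : R) : 0 <= a <= 1 -> derivable f (x + (a * s) *: u) u.
  move=> a01; have [|+ _] := df a 0 a01; first by rewrite ler01 lexx.
  by rewrite mul0r scale0r addr0.
have [a a01] : exists2 a : R, 0 <= a <= 1 &
    F (x + s *: u) - F x = s * 'D_u F (x + (a * s) *: u).
  apply: MVT_line => t t01; apply: derivableB; last exact: d0.
  by apply: derivable_shift_arg; exact: d1.
rewrite deriveB; [|exact/derivable_shift_arg/d1|exact: d0].
rewrite derive_shift_arg => Fa.
have [b b01 Fb] : exists2 b : R, 0 <= b <= 1 &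
    'D_u f (x + (a * s) *: u + s *: v) - 'D_u f (x + (a * s) *: u) =
    s * 'D_v ('D_u f) (x + (a * s) *: u + (b * s) *: v).
  exact: (@MVT_line _ _ ('D_u f) _ v s (fun t t01 => (df a t a01 t01).2)).
by exists a, b; split=> //; rewrite -Fb -Fa.
Qed.

Lemma derive_comm m (O : set 'rV[R]_m) f x i j :
  open O -> O x -> Ck_on 2 O f ->
  'D_(e_ i) ('D_(e_ j) f) x = 'D_(e_ j) ('D_(e_ i) f) x.
Proof.
move=> oO Ox Cf.
(* This difference quotient is symmetric in [i] and [j], and approximates the mixed derivative taken
   in either order. *)
pose Q i j (s : R) := s^-1 * (s^-1 * (f (x + s *: e_ j + s *: e_ i)
  - f (x + s *: e_ j) - (f (x + s *: e_ i) - f x))).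
have QC k l s : Q k l s = Q l k s.
  by rewrite /Q [x + _ + _]addrAC opprB addrACA [- f _ - _]addrC addrACA opprB.
suff main : forall i j (e : R), 0 < e -> exists2 d : R, 0 < d &
    forall s, 0 < s < d -> `|'D_(e_ i) ('D_(e_ j) f) x - Q i j s| <= e.
  apply/eqP; rewrite -subr_eq0 -normr_le0; apply/ler_addgt0Pr => e e0.
  have e20 : 0 < e / 2 by rewrite divr_gt0.
  have [s1 s10 H1] := main i j _ e20; have [s2 s20 H2] := main j i _ e20.
  pose s := Num.min s1 s2 / 2.
  have s0 : 0 < Num.min s1 s2 by rewrite lt_min s10.
  have ss : s < Num.min s1 s2 by rewrite /s ltr_pdivrMr// ltr_pMr// ltr1n.
  have /H1 {}H1 : 0 < s < s1.
    by rewrite divr_gt0//= (lt_le_trans ss)// ge_min lexx.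
  have /H2 {}H2 : 0 < s < s2.
    by rewrite divr_gt0//= (lt_le_trans ss)// ge_min lexx orbT.
  rewrite add0r [e]splitr; apply: le_trans (lerD H1 H2).
  by rewrite (QC j) [X in _ <= _ + X]distrC; exact: ler_distD.
move=> {}i {}j e e0.
have [_ /(_ j)[d1f [_ /(_ i)[d2f [c2f _]]]]] := Cf.
have : \forall y \near x, O y /\
    `|'D_(e_ i) ('D_(e_ j) f) x - 'D_(e_ i) ('D_(e_ j) f) y| <= e.
  near=> y; split; first by near: y; exact: open_nbhs_nbhs.
  by near: y; have /cvgrPdist_le := c2f x Ox; apply.
move=> /nbhs_ballP[d /= d0 xd].
(* The intermediate point given by [second_difference] is within [2 * s] of [x]. *)
exists (d / 2); first by rewrite divr_gt0.
move=> s /andP[s0 sd].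
have bxd (a b : R) : 0 <= a <= 1 -> 0 <= b <= 1 ->
    ball x d (x + (a * s) *: e_ j + (b * s) *: e_ i).
  move=> /andP[a0 a1] /andP[b0 b1]; rewrite -ball_normE /= -addrA opprD addNKr normrN.
  apply: (@le_lt_trans _ _ (s + s)); last first.
    by rewrite [d]splitr ltrD.
  apply: row_norm_le; first by rewrite addr_ge0// ltW.
  move=> l; rewrite !mxE eqxx /=; apply: le_trans (ler_normD _ _) _.
  by apply: lerD; rewrite !normrM ger0_norm// [`|s|]gtr0_norm//;
    (case: (l == _); rewrite ?normr1 ?normr0 ?mulr1 ?mulr0 ?(ltW s0)//);
    rewrite ler_piMl// ltW.
have [a [b [a01 b01 Qab]]] := @second_difference _ f x (e_ j) (e_ i) s
  (fun a b a01 b01 => conj (d1f _ (xd _ (bxd _ _ a01 b01)).1)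
                          (d2f _ (xd _ (bxd _ _ a01 b01)).1)).
rewrite /Q Qab !mulKf ?gt_eqF//.
by have [] := xd _ (bxd _ _ a01 b01).
Unshelve. all: by end_near. Qed.
End Ck.

(** * Smooth functions and vector fields *)

Section Manifold.
Context {R : realType} {m : nat} {M : smooth_manifold R m}.
Implicit Types (c : chart R m M) (U V : set M) (f g : M -> R) (p : M)
  (X Y Z : vfield M).

Definition partial c (i : 'I_m) f : M -> R := fun p =>
  'D_(e_ i) (f \o chart_param c) (chart_coord c p).

Lemma chart_im_openI c U : open U -> open (chart_coord c @` (U `&` chart_dom c)).
Proof.
move=> oU; rewrite openE => _ [p [Up cp] <-]; rewrite /interior.
have ocp : (chart_coord c @` chart_dom c) (chart_coord c p) by exists p.
near=> y.
have [q cq qy] : (chart_coord c @` chart_dom c) y.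
  by near: y; apply: open_nbhs_nbhs; split; [exact: chart_im_open|exact: ocp].
have Uy : U (chart_param c y).
  near: y; have := chart_param_cont ocp; apply; rewrite chart_coordK//.
  exact: open_nbhs_nbhs.
by exists q => //; split=> //; rewrite -qy chart_coordK// in Uy.
Unshelve. all: by end_near. Qed.

Arguments chart_im_openI : clear implicits.

(** Derivatives depend on germs only; this is the neighbourhood on which [chart_coord c] and
    [chart_param c] are mutually inverse, so that composites through charts can be rewritten. *)
Lemma near_chart_param c U p : open U -> U p -> chart_dom c p ->
  \forall x \near chart_coord c p, [/\ U (chart_param c x),
    chart_dom c (chart_param c x) & chart_coord c (chart_param c x) = x].
Proof.
move=> oU Up cp.
have : (chart_coord c @` (U `&` chart_dom c)) (chart_coord c p) by exists p.
move=> /(conj (chart_im_openI c _ oU))/open_nbhs_nbhs; apply: filterS.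
by move=> _ [q [Uq cq] <-]; rewrite chart_coordK.
Qed.

Lemma smooth_fun_sub U V f : V `<=` U -> smooth_fun U f -> smooth_fun V f.
Proof.
move=> VU sf c ac k; apply: Ck_on_sub (sf c ac k) => _ [p [Vp cp] <-].
by exists p => //; split=> //; exact: VU.
Qed.

Lemma smooth_fun_eq U f g :
  open U -> {in U, f =1 g} -> smooth_fun U f -> smooth_fun U g.
Proof.
move=> oU fg sf c ac k; apply: Ck_on_eq (sf c ac k); first exact: chart_im_openI.
move=> x; rewrite inE => -[p [Up cp] <-] /=.
by rewrite chart_coordK// fg// inE.
Qed.

Lemma smooth_fun_cover U f :
  (forall c, atlas c -> smooth_fun (U `&` chart_dom c) f) -> smooth_fun U f.
Proof. by move=> sf c ac; have := sf c ac c ac; rewrite -setIA setIid. Qed.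

Lemma smooth_fun_cst U (a : R) : open U -> smooth_fun U (cst a).
Proof. by move=> oU c ac k; apply: Ck_on_cst; exact: chart_im_openI. Qed.

Lemma smooth_funD U f g : open U ->
  smooth_fun U f -> smooth_fun U g -> smooth_fun U (fun p => f p + g p).
Proof.
move=> oU sf sg c ac k.
by apply: (Ck_onD (chart_im_openI c _ oU)); [exact: sf|exact: sg].
Qed.

Lemma smooth_funM U f g : open U ->
  smooth_fun U f -> smooth_fun U g -> smooth_fun U (fun p => f p * g p).
Proof.
move=> oU sf sg c ac k.
by apply: (Ck_onM (chart_im_openI c _ oU)); [exact: sf|exact: sg].
Qed.

Lemma smooth_funB U f g : open U ->
  smooth_fun U f -> smooth_fun U g -> smooth_fun U (fun p => f p - g p).
Proof.
move=> oU sf sg; have sN : smooth_fun U (fun p => cst (-1) p * g p).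
  by apply: smooth_funM => //; exact: smooth_fun_cst.
have := smooth_funD oU sf sN; apply: smooth_fun_eq => // p _ /=.
by rewrite mulN1r.
Qed.

Lemma smooth_fun_sum U n (f : 'I_n -> M -> R) : open U ->
  (forall i, smooth_fun U (f i)) -> smooth_fun U (fun p => \sum_(i < n) f i p).
Proof.
move=> oU sf c ac k; apply: (@Ck_on_sum _ _ _ _ _ (fun i => f i \o chart_param c)).
  exact: chart_im_openI.
by move=> i; exact: sf.
Qed.

Lemma smooth_coordinate c i : atlas c -> smooth_fun (chart_dom c) (coordinate c i).
Proof.
move=> ac c' ac'; rewrite setIC.
by have [+ _] := atlas_compatible ac' ac; apply.
Qed.

(** In any other chart [f] is its expression in [c] composed with a smooth transition map. *)
Lemma smooth_fun_chart c U f : atlas c -> open U -> U `<=` chart_dom c ->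
  Cinf_on (chart_coord c @` U) (f \o chart_param c) -> smooth_fun U f.
Proof.
move=> ac oU Uc Cf c' ac' k.
have oc' := chart_im_openI c' _ oU.
have UE : U = U `&` chart_dom c by apply/esym/setIidl.
have oc : open (chart_coord c @` U) by rewrite UE; exact: chart_im_openI.
pose h x := chart_coord c (chart_param c' x).
apply: (@Ck_on_eq _ _ _ _ ((f \o chart_param c) \o h)) => //.
  move=> x; rewrite inE => -[p [Up c'p] <-].
  by rewrite /h /= chart_coordK// chart_coordK//; exact: Uc.
apply: (Ck_on_comp oc' oc) => //.
- by move=> _ [p [Up c'p] <-]; exists p => //; rewrite /h chart_coordK.
- move=> i; apply: Ck_on_sub (smooth_coordinate i ac ac' k) => _ [p [Up c'p] <-].
  by exists p => //; split=> //; exact: Uc.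
Qed.

Lemma smooth_fun_differentiable c U f p : atlas c -> open U -> U p ->
  chart_dom c p -> smooth_fun U f ->
  differentiable (f \o chart_param c) (chart_coord c p).
Proof.
move=> ac oU Up cp sf; apply: (Ck_on_differentiable (chart_im_openI c _ oU)).
  by exists p.
exact: sf c ac 1%N.
Qed.

(** * Differentials and coordinate vector fields *)

Lemma derive_change_chart c c' U f p (v : 'rV[R]_m) :
  atlas c -> atlas c' -> open U -> U p -> chart_dom c p -> chart_dom c' p ->
  smooth_fun U f ->
  'D_v (f \o chart_param c') (chart_coord c' p) =
  \sum_(i < m) 'D_v (coordinate c i \o chart_param c') (chart_coord c' p) *
    partial c i f p.
Proof.
move=> ac ac' oU Up cp c'p sf.
pose h x := chart_coord c (chart_param c' x).
have hp : h (chart_coord c' p) = chart_coord c p by rewrite /h chart_coordK.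
transitivity ('D_v ((f \o chart_param c) \o h) (chart_coord c' p)).
  apply: near_eq_derive.
  have := near_chart_param (chart_dom_open c) cp c'p; apply: filterS.
  by move=> x [cx c'x _]; rewrite /h /= chart_coordK.
rewrite derive_comp_row.
- by apply: eq_bigr => i _; rewrite hp.
- by rewrite hp; exact: smooth_fun_differentiable sf.
- move=> i; have -> : (fun y => h y 0 i) = coordinate c i \o chart_param c' by [].
  exact: smooth_fun_differentiable ac' (chart_dom_open c) cp c'p
    (smooth_coordinate i ac).
Qed.

Lemma dfun_partial c U f p (v : 'rV[R]_m) : atlas c -> open U -> U p ->
  chart_dom c p -> smooth_fun U f ->
  dfun f p v = \sum_(i < m) dfun (coordinate c i) p v * partial c i f p.
Proof.
move=> ac oU Up cp sf; apply: derive_change_chart sf => //.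
- exact: chart_at_atlas.
- exact: chart_at_dom.
Qed.

(** The components of [coord_vfield] are the derivatives of the coordinates of [chart_at p] in the
    chart [c], so the chain rule from [c] to [chart_at p] reassembles a partial derivative in
    [c]. *)
Lemma dfun_coord_vfield c U f p i : atlas c -> open U -> U p ->
  chart_dom c p -> smooth_fun U f ->
  dfun f p (coord_vfield c i p) = partial c i f p.
Proof.
move=> ac oU Up cp sf; rewrite /dfun derive_row_sum; last first.
  by apply: smooth_fun_differentiable sf => //;
    [exact: chart_at_atlas|exact: chart_at_dom].
rewrite /partial.
rewrite (derive_change_chart _ (chart_at_atlas p) ac oU Up (chart_at_dom p) cp sf).
by apply: eq_bigr => k _; rewrite mxE.
Qed.

Lemma derive_coord (x v : 'rV[R]_m) i : 'D_v (fun y : 'rV[R]_m => y 0 i : R) x = v 0 i.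
Proof.
by have := @derive_id _ _ x v; rewrite derive_mx// => /rowP/(_ i); rewrite mxE.
Qed.

Lemma derive_coordinate c p i v : chart_dom c p ->
  'D_v (coordinate c i \o chart_param c) (chart_coord c p) = v 0 i.
Proof.
move=> cp; rewrite -[RHS](derive_coord (chart_coord c p)); apply: near_eq_derive.
have := near_chart_param openT I cp; apply: filterS => x [_ _ xE].
by rewrite /= /coordinate xE.
Qed.

Lemma partial_coordinate c p i j : chart_dom c p ->
  partial c i (coordinate c j) p = (i == j)%:R.
Proof. by move=> cp; rewrite /partial derive_coordinate// !mxE eqxx eq_sym. Qed.

Lemma dcoordinate_coord_vfield c p i j : atlas c -> chart_dom c p ->
  dfun (coordinate c j) p (coord_vfield c i p) = (i == j)%:R.
Proof.
move=> ac cp; rewrite (dfun_coord_vfield _ _ (chart_dom_open c))//.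
  exact: partial_coordinate.
exact: smooth_coordinate.
Qed.

(** The [k]-th entry of [v] is the derivative along [v] of the [k]-th coordinate of [chart_at p];
    the chain rule through [c] expands it. *)
Lemma tangent_expand c p (v : 'rV[R]_m) : atlas c -> chart_dom c p ->
  v = \sum_(i < m) dfun (coordinate c i) p v *: coord_vfield c i p.
Proof.
move=> ac cp; apply/rowP => k; rewrite summxE.
under eq_bigr do rewrite !mxE -/(partial c _ (coordinate (chart_at p) k) p).
rewrite -(dfun_partial _ ac (chart_dom_open (chart_at p)) (chart_at_dom p) cp).
  by rewrite /dfun derive_coordinate//; exact: chart_at_dom.
exact/smooth_coordinate/chart_at_atlas.
Qed.

Lemma dfun_eq U f g p v : open U -> U p -> {in U, f =1 g} ->
  dfun f p v = dfun g p v.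
Proof.
move=> oU Up fg; apply: near_eq_derive.
have := near_chart_param oU Up (chart_at_dom p); apply: filterS => x [Ux _ _].
by rewrite /= fg// inE.
Qed.

Lemma dfun_differentiable U f p : open U -> U p -> smooth_fun U f ->
  differentiable (f \o chart_param (chart_at p)) (chart_coord (chart_at p) p).
Proof.
move=> oU Up; apply: smooth_fun_differentiable => //.
- exact: chart_at_atlas.
- exact: chart_at_dom.
Qed.

Lemma dfun_linear U f p (a : R) v w : open U -> U p -> smooth_fun U f ->
  dfun f p (a *: v + w) = a * dfun f p v + dfun f p w.
Proof.
by move=> oU Up /(dfun_differentiable oU Up) df; rewrite /dfun !deriveE// linearP.
Qed.

Lemma dfun_lin0 U f p : open U -> U p -> smooth_fun U f -> dfun f p 0 = 0.
Proof.
by move=> oU Up /(dfun_differentiable oU Up) df; rewrite /dfun !deriveE// linear0.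
Qed.

Lemma dfun_cst (a : R) p v : dfun (cst a : M -> R) p v = 0.
Proof. exact: derive_cst. Qed.

Lemma dfunM U f g p v : open U -> U p -> smooth_fun U f -> smooth_fun U g ->
  dfun (fun q => f q * g q) p v = f p * dfun g p v + g p * dfun f p v.
Proof.
move=> oU Up /(dfun_differentiable oU Up) df /(dfun_differentiable oU Up) dg.
have := deriveM (diff_derivable (v := v) df) (diff_derivable (v := v) dg).
by rewrite /= chart_coordK//; exact: chart_at_dom.
Qed.

Lemma dfun_sum U n (f : 'I_n -> M -> R) p v : open U -> U p ->
  (forall i, smooth_fun U (f i)) ->
  dfun (fun q => \sum_(i < n) f i q) p v = \sum_(i < n) dfun (f i) p v.
Proof.
move=> oU Up sf; rewrite /dfun -derive_sum.
  by congr ('D_v _ _); apply/funext => x; rewrite fct_sumE.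
by move=> i; apply/diff_derivable/(dfun_differentiable oU Up)/sf.
Qed.

Lemma smooth_partial c U f i : atlas c -> open U -> smooth_fun U f ->
  smooth_fun (U `&` chart_dom c) (partial c i f).
Proof.
move=> ac oU sf; apply: (smooth_fun_chart ac) => //.
- by apply: openI => //; exact: chart_dom_open.
- move=> k; have [_ /(_ i)[_]] := sf c ac k.+1.
  apply: Ck_on_eq; first exact: chart_im_openI.
  move=> x; rewrite inE => -[p [Up cp] <-].
  by rewrite /partial /= chart_coordK.
Qed.

(** * Smooth vector fields and their brackets *)

Lemma smooth_vfield_sub U V X : V `<=` U -> smooth_vfield U X -> smooth_vfield V X.
Proof. by move=> VU sX c ac i; apply: smooth_fun_sub (sX c ac i); exact: setSI. Qed.

Lemma vact_partial c U f X : atlas c -> open U -> smooth_fun U f ->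
  forall p, U p -> chart_dom c p ->
  vact X f p = \sum_(i < m) vact X (coordinate c i) p * partial c i f p.
Proof. by move=> ac oU sf p Up cp; apply: dfun_partial sf. Qed.

Lemma smooth_vact U X f : open U -> smooth_vfield U X -> smooth_fun U f ->
  smooth_fun U (vact X f).
Proof.
move=> oU sX sf; apply: smooth_fun_cover => c ac.
have oUc : open (U `&` chart_dom c) by apply: openI => //; exact: chart_dom_open.
apply: (@smooth_fun_eq _ (fun p =>
  \sum_(i < m) vact X (coordinate c i) p * partial c i f p)) => //.
  by move=> p; rewrite inE => -[Up cp]; rewrite (vact_partial _ ac oU sf).
apply: smooth_fun_sum => // i; apply: smooth_funM => //; first exact: sX.
exact: smooth_partial.
Qed.

Lemma smooth_vfield_eq U X Y : open U -> {in U, X =1 Y} ->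
  smooth_vfield U X -> smooth_vfield U Y.
Proof.
move=> oU XY sX c ac i; have := sX c ac i.
apply: smooth_fun_eq; first by apply: openI => //; exact: chart_dom_open.
by move=> p; rewrite inE => -[Up _]; rewrite /vact XY// inE.
Qed.

Lemma smooth_vfieldD U X Y : open U -> smooth_vfield U X -> smooth_vfield U Y ->
  smooth_vfield U (fun p => X p + Y p).
Proof.
move=> oU sX sY c ac i.
have oUc : open (U `&` chart_dom c) by apply: openI => //; exact: chart_dom_open.
apply: smooth_fun_eq (smooth_funD oUc (sX c ac i) (sY c ac i)) => //.
move=> p; rewrite inE => -[Up cp]; rewrite /vact -[X p in RHS]scale1r.
by rewrite (dfun_linear _ _ _ (chart_dom_open c) cp) ?mul1r//; exact: smooth_coordinate.
Qed.

Lemma smooth_vfieldZ U X f : open U -> smooth_vfield U X -> smooth_fun U f ->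
  smooth_vfield U (fun p => f p *: X p).
Proof.
move=> oU sX sf c ac i.
have oUc : open (U `&` chart_dom c) by apply: openI => //; exact: chart_dom_open.
have sf' := smooth_fun_sub (@subIsetl _ U (chart_dom c)) sf.
apply: smooth_fun_eq (smooth_funM oUc sf' (sX c ac i)) => //.
move=> p; rewrite inE => -[Up cp]; have sc := smooth_coordinate i ac.
rewrite /vact -[f p *: X p]addr0 (dfun_linear _ _ _ (chart_dom_open c) cp sc).
by rewrite (dfun_lin0 (chart_dom_open c) cp sc) addr0.
Qed.

Lemma smooth_vfield0 U : open U -> smooth_vfield U (fun=> 0).
Proof.
move=> oU c ac i.
have oUc : open (U `&` chart_dom c) by apply: openI => //; exact: chart_dom_open.
apply: smooth_fun_eq (smooth_fun_cst 0 oUc) => // p; rewrite inE => -[_ cp].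
by rewrite /vact (dfun_lin0 (chart_dom_open c) cp)//; exact: smooth_coordinate.
Qed.

Lemma smooth_vfield_sum U n (X : 'I_n -> vfield M) : open U ->
  (forall i, smooth_vfield U (X i)) ->
  smooth_vfield U (fun p => \sum_(i < n) X i p).
Proof.
move=> oU; elim: n X => [|n IH] X sX.
  by under eq_fun do rewrite big_ord0; exact: smooth_vfield0.
by under eq_fun do rewrite big_ord_recr; apply: smooth_vfieldD => //; exact: IH.
Qed.

Lemma smooth_coord_vfield c i : atlas c ->
  smooth_vfield (chart_dom c) (coord_vfield c i).
Proof.
move=> ac c' ac' j; have oc := chart_dom_open c; have oc' := chart_dom_open c'.
have sc' := smooth_coordinate j ac'.
rewrite setIC; apply: smooth_fun_eq (smooth_partial i ac oc' sc').
  exact: openI.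
move=> p; rewrite inE => -[c'p cp].
by rewrite /vact (dfun_coord_vfield _ ac oc').
Qed.

Lemma partial_comm c U f i j p : atlas c -> open U -> U p -> chart_dom c p ->
  smooth_fun U f ->
  partial c i (partial c j f) p = partial c j (partial c i f) p.
Proof.
move=> ac oU Up cp sf.
have E k l : partial c k (partial c l f) p =
    'D_(e_ k) ('D_(e_ l) (f \o chart_param c)) (chart_coord c p).
  apply: near_eq_derive; have := near_chart_param openT I cp.
  by apply: filterS => x [_ _ xE]; rewrite /= /partial xE.
rewrite !E; apply: (derive_comm _ _ (chart_im_openI c _ oU)).
  by exists p.
exact: sf.
Qed.

(** The definition of [bracket] provides this identity only for the coordinates of [chart_at p]. For
    a general [f], both iterated derivatives are expanded in that chart, and the second-order terms
    cancel by [partial_comm]. *)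
Lemma dfun_bracket U X Y f p : open U -> U p -> smooth_vfield U X ->
  smooth_vfield U Y -> smooth_fun U f ->
  dfun f p (bracket X Y p) = vact X (vact Y f) p - vact Y (vact X f) p.
Proof.
move=> oU Up sX sY sf; set c := chart_at p.
have ac : atlas c := chart_at_atlas p.
have cp : chart_dom c p := chart_at_dom p.
have oUc : open (U `&` chart_dom c) by apply: openI => //; exact: chart_dom_open.
have Ucp : (U `&` chart_dom c) p by [].
have second Z W : smooth_vfield U Z -> smooth_vfield U W -> vact Z (vact W f) p =
    \sum_(i < m) vact Z (vact W (coordinate c i)) p * partial c i f p +
    \sum_(i < m) \sum_(j < m) vact W (coordinate c i) p *
       (vact Z (coordinate c j) p * partial c j (partial c i f) p).
  move=> sZ sW.
  rewrite /vact (@dfun_eq (U `&` chart_dom c) _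
     (fun q => \sum_(i < m) vact W (coordinate c i) q * partial c i f q))//; last first.
    by move=> q; rewrite inE => -[Uq cq]; rewrite -(vact_partial _ ac oU sf).
  rewrite (dfun_sum _ oUc Ucp); last first.
    by move=> i; apply: smooth_funM => //; [exact: sW|exact: smooth_partial].
  rewrite -big_split /=; apply: eq_bigr => i _.
  rewrite (dfunM _ oUc Ucp); [|exact: sW|exact: smooth_partial].
  rewrite addrC; congr (_ + _); last exact: mulrC.
  have sfi := smooth_partial i ac oU sf.
  by rewrite (dfun_partial _ ac oUc Ucp cp sfi) mulr_sumr.
rewrite !second// (dfun_partial _ ac oU Up cp sf).
rewrite [X in _ = _ - (_ + X)]exchange_big /=.
rewrite opprD addrACA -sumrB -[LHS]addr0; congr (_ + _).
  apply: eq_bigr => i _; rewrite -mulrBl; congr (_ * _).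
  by rewrite /dfun derive_coordinate// mxE.
apply/esym/eqP; rewrite subr_eq0; apply/eqP; apply: eq_bigr => i _.
apply: eq_bigr => j _; rewrite (partial_comm i j ac oU)//; ring.
Qed.

(** The chart used to define [bracket X Y] varies with the point; [dfun_bracket] yields its
    components in a fixed chart, which are visibly smooth. *)
Lemma smooth_bracket U X Y : open U -> smooth_vfield U X -> smooth_vfield U Y ->
  smooth_vfield U (bracket X Y).
Proof.
move=> oU sX sY c ac i.
have oUc : open (U `&` chart_dom c) by apply: openI => //; exact: chart_dom_open.
have sX' := smooth_vfield_sub (@subIsetl _ U (chart_dom c)) sX.
have sY' := smooth_vfield_sub (@subIsetl _ U (chart_dom c)) sY.
have sc := smooth_fun_sub (@subIsetr _ U (chart_dom c)) (smooth_coordinate i ac).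
have s1 := smooth_vact oUc sX' (sY c ac i).
have s2 := smooth_vact oUc sY' (sX c ac i).
apply: smooth_fun_eq (smooth_funB oUc s1 s2) => // p; rewrite inE => Up.
by rewrite [RHS]/vact (dfun_bracket oUc Up sX' sY' sc).
Qed.
End Manifold.

(** * Darboux and cyclic indices *)

Section DarbouxIndices.
Context {n : nat}.
Implicit Types (i j : 'I_n) (b : 'I_3).

Lemma ix_val i : ix i = i :> nat.
Proof. by rewrite inordK//; have := ltn_ord i; lia. Qed.
Lemma iy_val i : iy i = (n + i)%N :> nat.
Proof. by rewrite inordK//; have := ltn_ord i; lia. Qed.
Lemma iu_val i : iu i = (2 * n + i)%N :> nat.
Proof. by rewrite inordK//; have := ltn_ord i; lia. Qed.
Lemma iv_val i : iv i = (3 * n + i)%N :> nat.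
Proof. by rewrite inordK//; have := ltn_ord i; lia. Qed.
Lemma iz_val b : iz n b = (4 * n + b)%N :> nat.
Proof. by rewrite inordK//; have := ltn_ord b; lia. Qed.
Definition index_val := (ix_val, iy_val, iu_val, iv_val, iz_val).

Lemma index_eq :
  (forall i j, (ix i == ix j) = (i == j)) * (forall i j, (iy i == iy j) = (i == j)) *
  (forall i j, (iu i == iu j) = (i == j)) * (forall i j, (iv i == iv j) = (i == j)) *
  (forall b b', (iz n b == iz n b') = (b == b')).
Proof.
by do !split; move=> i j; rewrite -val_eqE /= !index_val ?eqn_add2l.
Qed.

Lemma index_neq :
  (forall i j, (ix i == iy j) = false) * (forall i j, (iy i == ix j) = false) *
  (forall i j, (ix i == iu j) = false) * (forall i j, (iu i == ix j) = false) *
  (forall i j, (ix i == iv j) = false) * (forall i j, (iv i == ix j) = false) *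
  (forall i j, (iy i == iu j) = false) * (forall i j, (iu i == iy j) = false) *
  (forall i j, (iy i == iv j) = false) * (forall i j, (iv i == iy j) = false) *
  (forall i j, (iu i == iv j) = false) * (forall i j, (iv i == iu j) = false).
Proof.
by do !split; move=> i j; apply/negbTE/negP => /eqP/(congr1 val) /=;
  rewrite !index_val; have := ltn_ord i; have := ltn_ord j; lia.
Qed.

Lemma index_neqz :
  (forall i b, (ix i == iz n b) = false) * (forall i b, (iz n b == ix i) = false) *
  (forall i b, (iy i == iz n b) = false) * (forall i b, (iz n b == iy i) = false) *
  (forall i b, (iu i == iz n b) = false) * (forall i b, (iz n b == iu i) = false) *
  (forall i b, (iv i == iz n b) = false) * (forall i b, (iz n b == iv i) = false).
Proof.
by do !split; move=> i b; apply/negbTE/negP => /eqP/(congr1 val) /=;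
  rewrite !index_val; have := ltn_ord i; lia.
Qed.

Variant darboux_index_spec : 'I_(4 * n).+3 -> Type :=
  | IndexX i : darboux_index_spec (ix i)
  | IndexY i : darboux_index_spec (iy i)
  | IndexU i : darboux_index_spec (iu i)
  | IndexV i : darboux_index_spec (iv i)
  | IndexZ b : darboux_index_spec (iz n b).

Lemma darboux_indexP k : darboux_index_spec k.
Proof.
have [kx|kx] := ltnP k n.
  have -> : k = ix (Ordinal kx) by apply: val_inj; rewrite /= ix_val.
  by constructor.
(* In this and the next cases, the failure of the earlier tests makes the truncated subtraction
   exact. *)
have [ky|ky] := ltnP (k - n) n.
  have -> : k = iy (Ordinal ky) by apply: val_inj; rewrite /= iy_val /=; lia.
  by constructor.
have [ku|ku] := ltnP (k - 2 * n) n.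
  have -> : k = iu (Ordinal ku) by apply: val_inj; rewrite /= iu_val /=; lia.
  by constructor.
have [kv|kv] := ltnP (k - 3 * n) n.
  have -> : k = iv (Ordinal kv) by apply: val_inj; rewrite /= iv_val /=; lia.
  by constructor.
have kz : (k - 4 * n < 3)%N by have := ltn_ord k; lia.
have -> : k = iz n (Ordinal kz) by apply: val_inj; rewrite /= iz_val /=; lia.
by constructor.
Qed.
End DarbouxIndices.

Section CyclicIndices.
Context {R : realType} {V : lmodType R}.
Implicit Types (a : 'I_3) (F : 'I_3 -> V).

(** Starting the sum at [a] lets one cyclic argument serve all three structures. *)
Lemma sum_cyclic F a : \sum_(b < 3) F b = F a + F (a + 1) + F (a + 2).
Proof.
have -> : \sum_(b < 3) F b = F 0 + F 1 + F 2.
  by rewrite !big_ord_recr big_ord0 /= add0r; congr (F _ + F _ + F _); apply: val_inj.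
case: a => [[|[|[]]]//= ha]; [|rewrite -addrA addrC|rewrite addrC addrA];
  by congr (F _ + F _ + F _); apply: val_inj.
Qed.

Lemma sum_symbol_diag F a : \sum_(c < 3) levi_civita_symbol a a c *: F c = 0.
Proof.
apply: big1 => c _; rewrite /levi_civita_symbol.
by case: a => [[|[|[]]]//= ha]; rewrite andbF scale0r.
Qed.

Lemma sum_symbol1 F a :
  \sum_(c < 3) levi_civita_symbol a (a + 1) c *: F c = F (a + 2).
Proof.
rewrite (sum_cyclic _ a) /levi_civita_symbol.
by case: a => [[|[|[]]]//= ha]; rewrite !scale0r scale1r !add0r.
Qed.

End CyclicIndices.

(** * The metric in a Darboux chart *)

Section ThreeContact.
Context {R : realType} {n : nat} {M : smooth_manifold R (4 * n).+3}.
Variables (phi : 'I_3 -> endo M) (xi : 'I_3 -> vfield M)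
  (eta : 'I_3 -> form1 M) (g : form2 M).
Hypothesis h3 : is_almost_3contact_metric phi xi eta g.
Implicit Types (a b : 'I_3) (p : M) (s t v w : 'rV[R]_((4 * n).+3)).

Lemma metric_linearl p (k : R) u v w : g p (k *: u + v) w = k * g p u w + g p v w.
Proof. by case: h3 => _ [[]]. Qed.

Lemma metricC p v w : g p v w = g p w v.
Proof. by case: h3 => _ [[]]. Qed.

Lemma metric_linearr p (k : R) u v w : g p w (k *: u + v) = k * g p w u + g p w v.
Proof. by rewrite metricC metric_linearl ![g p _ w]metricC. Qed.

Lemma metric0l p v : g p 0 v = 0.
Proof. by have := metric_linearl p (-1) 0 0 v; rewrite scaler0 addr0 mulN1r addNr. Qed.

Lemma metric0r p v : g p v 0 = 0.
Proof. by rewrite metricC metric0l. Qed.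

Lemma metric_eq0 p v : g p v v = 0 -> v = 0.
Proof.
move=> gv; apply/eqP/negP => /negP v0.
by case: h3 => _ [[_ _ /(_ p v v0)]]; rewrite gv ltxx.
Qed.

Lemma metricZr p (k : R) v w : g p v (k *: w) = k * g p v w.
Proof. by rewrite -[k *: w]addr0 metric_linearr metric0r addr0. Qed.

Lemma phi_linear a p (k : R) v w : phi a p (k *: v + w) = k *: phi a p v + phi a p w.
Proof. by case: h3 => /(_ a)[[+ _] _ _ _ _] _; apply. Qed.

Lemma eta_linear a p (k : R) v w : eta a p (k *: v + w) = k * eta a p v + eta a p w.
Proof. by case: h3 => /(_ a)[_ _ [+ _] _ _] _; apply. Qed.

Lemma phi0 a p : phi a p 0 = 0.
Proof. by have := phi_linear a p (-1) 0 0; rewrite scaler0 addr0 scaleN1r addNr. Qed.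

Lemma eta0 a p : eta a p 0 = 0.
Proof. by have := eta_linear a p (-1) 0 0; rewrite scaler0 addr0 mulN1r addNr. Qed.

Lemma phi_phi a p v : phi a p (phi a p v) = - v + eta a p v *: xi a p.
Proof. by case: h3 => /(_ a)[]. Qed.

Lemma eta_xi a p : eta a p (xi a p) = 1.
Proof. by case: h3 => /(_ a)[]. Qed.

Lemma phi_xi a p : phi a p (xi a p) = 0.
Proof.
case: h3 => _ [_ [_ /(_ a a p)[_ -> _]]].
exact: (sum_symbol_diag (fun c => xi c p)).
Qed.

Lemma phi_xi1 a p : phi a p (xi (a + 1) p) = xi (a + 2) p.
Proof.
case: h3 => _ [_ [_ /(_ a (a + 1) p)[_ -> _]]].
exact: (sum_symbol1 (fun c => xi c p)).
Qed.

Lemma eta_phi1 a p v : eta a p (phi (a + 1) p v) = eta (a + 2) p v.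
Proof.
case: h3 => _ [_ [_ /(_ a (a + 1) p)[_ _ ->]]].
exact: (sum_symbol1 (V := R^o) (fun c => eta c p v)).
Qed.

Lemma phi_phi1 a p v : eta (a + 1) p v = 0 ->
  phi a p (phi (a + 1) p v) = phi (a + 2) p v.
Proof.
move=> ev; case: h3 => _ [_ [_ /(_ a (a + 1) p)[/(_ v) + _ _]]].
rewrite ev scale0r subr0 => ->; rewrite (sum_symbol1 (fun c => phi c p v)).
by case: a {ev} => [[|[|[]]]//= ha]; rewrite scale0r subr0.
Qed.

Lemma metric_xi a p v : g p v (xi a p) = eta a p v.
Proof.
case: h3 => _ [_ [/(_ a p v (xi a p)) + _]].
by rewrite phi_xi metric0r eta_xi mulr1 => /esym/eqP; rewrite subr_eq0 => /eqP.
Qed.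

(** Since [phi a] squares to minus the identity plus [eta a] times [xi a], a vector killed by both
    [phi a] and [eta a] is zero. Testing against all [s] uses nondegeneracy of [g], so values of
    [Phi a] are enough to compare vectors. *)
Lemma phi_eqP a p v w : eta a p v = eta a p w ->
  (forall s, g p s (phi a p v) = g p s (phi a p w)) -> v = w.
Proof.
move=> evw gvw; apply/eqP; rewrite -subr_eq0; apply/eqP.
have vwE : v - w = -1 *: w + v by rewrite scaleN1r addrC.
have pvw : phi a p (v - w) = 0.
  apply: (@metric_eq0 p); rewrite [X in g p _ X](_ : _ = -1 *: phi a p w + phi a p v).
    by rewrite metric_linearr gvw mulN1r addNr.
  by rewrite vwE phi_linear.
have := phi_phi a p (v - w); rewrite pvw phi0 {2}vwE eta_linear evw mulN1r addNr.
by rewrite scale0r addr0 => /esym/eqP; rewrite oppr_eq0 => /eqP.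
Qed.

Lemma fundamental_sum3 a p s u v w (x y k1 k2 k3 : R) :
  g p s (phi a p u) = 0 -> g p s (phi a p v) = x -> g p s (phi a p w) = y ->
  g p s (phi a p (k1 *: u + k2 *: v + k3 *: w)) = k2 * x + k3 * y.
Proof.
move=> gu gv gw; rewrite -addrA -[k3 *: w]addr0 !phi_linear phi0 !metric_linearr.
by rewrite metric0r gu gv gw mulr0 add0r addr0.
Qed.

(** On such [t], [phi (a + 2) t] is [phi a (phi (a + 1) t)]; the hypothesis on [t'] then lets
    [phi a] be cancelled by [phi_eqP]. *)
Lemma phi_horizontal a p t t' :
  (forall b, eta b p t = 0) -> (forall b, eta b p t' = 0) ->
  (forall s, g p s (phi a p t') = g p s (phi (a + 2) p t)) ->
  phi (a + 1) p t = t'.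
Proof.
move=> et et' H; apply: (@phi_eqP a p).
  by rewrite eta_phi1 et et'.
by move=> s; rewrite phi_phi1.
Qed.

(** * The three forms and the metric at a point of a Darboux chart *)

Variable c : chart R (4 * n).+3 M.
Hypothesis ac : atlas c.
Hypothesis dc : is_darboux (fun a => fundamental_form g (phi a)) xi c.
Hypothesis sc : has_standard_forms (fun a => fundamental_form g (phi a)) c.
Variable p : M.
Hypothesis cp : chart_dom c p.

Local Notation D k := (coord_vfield c k p).
Local Notation W k := (dfun (coordinate c k) p).

Lemma wedge_coord i j k s :
  wedge (dfun (coordinate c i)) (dfun (coordinate c j)) p s (D k) =
  2^-1 * (W i s * (k == j)%:R - (k == i)%:R * W j s).
Proof. by rewrite /wedge !dcoordinate_coord_vfield. Qed.

Lemma sum_only m (F : 'I_m -> R) j : (forall i, i != j -> F i = 0) ->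
  \sum_(i < m) F i = F j.
Proof. by move=> F0; rewrite (bigD1 j)//= big1// addr0. Qed.

Let coordE := (wedge_coord, @index_eq n, @index_neq n, @index_neqz n, eqxx).

(** The factor -2 of the standard form cancels the 1/2 of [wedge], and only the summand of index [j]
    involves the coordinate field. *)
Lemma Phi0_coord s (j : 'I_n) :
  [/\ g p s (phi 0 p (D (ix j))) = W (iy j) s,
      g p s (phi 0 p (D (iy j))) = - W (ix j) s,
      g p s (phi 0 p (D (iu j))) = W (iv j) s &
      g p s (phi 0 p (D (iv j))) = - W (iu j) s].
Proof.
have E t := let: And3 h _ _ := sc cp s t in h.
rewrite /fundamental_form in E.
split; rewrite E;
  (rewrite (@sum_only _ _ j) => [|i ij];
    rewrite !coordE ?[j == i]eq_sym ?(negbTE ij) /= ?mulr0n; lra).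
Qed.

Lemma Phi1_coord s (j : 'I_n) :
  [/\ g p s (phi 1 p (D (ix j))) = W (iu j) s,
      g p s (phi 1 p (D (iy j))) = - W (iv j) s,
      g p s (phi 1 p (D (iu j))) = - W (ix j) s &
      g p s (phi 1 p (D (iv j))) = W (iy j) s].
Proof.
have E t := let: And3 _ h _ := sc cp s t in h.
rewrite /fundamental_form in E.
split; rewrite E;
  (rewrite (@sum_only _ _ j) => [|i ij];
    rewrite !coordE ?[j == i]eq_sym ?(negbTE ij) /= ?mulr0n; lra).
Qed.

Lemma Phi2_coord s (j : 'I_n) :
  [/\ g p s (phi 2 p (D (ix j))) = W (iv j) s,
      g p s (phi 2 p (D (iy j))) = W (iu j) s,
      g p s (phi 2 p (D (iu j))) = - W (iy j) s &
      g p s (phi 2 p (D (iv j))) = - W (ix j) s].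
Proof.
have E t := let: And3 _ _ h := sc cp s t in h.
rewrite /fundamental_form in E.
split; rewrite E;
  (rewrite (@sum_only _ _ j) => [|i ij];
    rewrite !coordE ?[j == i]eq_sym ?(negbTE ij) /= ?mulr0n; lra).
Qed.

(** The vertical parts are cyclic: each is -2 times the wedge of the differentials of [z_(a+1)] and
    [z_(a+2)]. The plus sign in the second form comes from writing its two factors in the opposite
    order. *)
Lemma Phi_coordz a s :
  [/\ g p s (phi a p (D (iz n a))) = 0,
      g p s (phi a p (D (iz n (a + 1)))) = W (iz n (a + 2)) s &
      g p s (phi a p (D (iz n (a + 2)))) = - W (iz n (a + 1)) s].
Proof.
have [a0|[a1|a2]] : a = 0 \/ a = 1 \/ a = 2.
  by case: a => [[|[|[]]]//= ha]; [left|right; left|right; right]; exact: val_inj.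
- rewrite {}a0; have E t := let: And3 h _ _ := sc cp s t in h.
  rewrite /fundamental_form in E.
  split; rewrite E;
    (rewrite big1 => [|i _]; rewrite !coordE /= ?mulr0n; lra).
- rewrite {}a1; have -> : 1 + 1 = 2 :> 'I_3 by exact: val_inj.
  have -> : 1 + 2 = 0 :> 'I_3 by exact: val_inj.
  have E t := let: And3 _ h _ := sc cp s t in h.
  rewrite /fundamental_form in E.
  split; rewrite E;
    (rewrite big1 => [|i _]; rewrite !coordE /= ?mulr0n; lra).
- rewrite {}a2; have -> : 2 + 1 = 0 :> 'I_3 by exact: val_inj.
  have -> : 2 + 2 = 1 :> 'I_3 by exact: val_inj.
  have E t := let: And3 _ _ h := sc cp s t in h.
  rewrite /fundamental_form in E.
  split; rewrite E;
    (rewrite big1 => [|i _]; rewrite !coordE /= ?mulr0n; lra).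
Qed.

(* By [phi a (xi a) = 0], the form [Phi a] vanishes on [xi a]; on the span of the
   [d/dz_b] its kernel is the line of [d/dz_a]. *)
Lemma xi_coord : exists A : 'I_3 -> R,
  forall a, xi a p = A a *: D (iz n a).
Proof.
have [_ [A xiA]] := dc.
exists (fun a => A a a (\row_k coordinate c (iz n k) p)) => a.
have := xiA a p cp; rewrite (sum_cyclic _ a); set z := \row_k _; set B := A a.
have neq : (a + 1 == a + 2) = false.
  by move: (a) => b; case: b => [[|[|[]]]].
have : forall s, _ := Phi_coordz a.
move: (a + 1) (a + 2) neq => b b' neq Phiz xiE.
have Phi_xi s : B b z * W (iz n b') s - B b' z * W (iz n b) s = 0.
  have [Pa Pb Pb'] := Phiz s.
  by rewrite -mulrN -(fundamental_sum3 (B a z) _ _ Pa Pb Pb') -xiE phi_xi metric0r.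
have := Phi_xi (D (iz n b)).
rewrite !dcoordinate_coord_vfield// !index_eq eqxx neq mulr0 mulr1 sub0r.
move=> /eqP; rewrite oppr_eq0 => /eqP Bb'.
have := Phi_xi (D (iz n b')).
rewrite !dcoordinate_coord_vfield// !index_eq eqxx eq_sym neq mulr0 mulr1 subr0.
by move=> Bb; rewrite xiE Bb Bb' !scale0r !addr0.
Qed.

Let cyclicE (b : 'I_3) :
  (b + 1 + 1 = b + 2) * (b + 1 + 2 = b) * (b + 2 + 1 = b) * (b + 2 + 2 = b + 1).
Proof. by case: b => [[|[|[]]]//= hb]; do !split; exact: val_inj. Qed.

(** Both formulas compute [g(., xi a)]: directly from [xi a = A a *: D (iz n a)], and from
    [xi a = phi (a + 1) (xi (a + 2))], which brings in [Phi (a + 1)]. Then [eta (xi) = 1] makes the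
    pairwise products of the [A a] equal to 1, so the three coefficients are one common sign. *)
Lemma eta_coord : exists A : 'I_3 -> R, [/\
  forall a, A (a + 1) * A (a + 2) = 1,
  forall a s, eta a p s = A (a + 2) * W (iz n a) s &
  forall a s, eta a p s = A a * g p s (D (iz n a))].
Proof.
have [A xiA] := xi_coord.
have metricA a s : eta a p s = A a * g p s (D (iz n a)).
  by rewrite -metric_xi xiA metricZr.
have etaA a s : eta a p s = A (a + 2) * W (iz n a) s.
  have [_ + _] := Phi_coordz (a + 1) s; rewrite !cyclicE => <-.
  rewrite -metricZr -[_ *: _]addr0 -(phi0 (a + 1) p) -phi_linear addr0.
  by rewrite -xiA -[a + 2](cyclicE a) phi_xi1 cyclicE metric_xi.
exists A; split=> // a.
have := eta_xi (a + 2) p; rewrite etaA cyclicE xiA -[_ *: _]addr0.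
have sz := smooth_coordinate (iz n (a + 2)) ac.
rewrite (dfun_linear _ _ _ (chart_dom_open c) cp sz).
rewrite (dfun_lin0 (chart_dom_open c) cp sz) addr0.
by rewrite dcoordinate_coord_vfield// eqxx mulr1.
Qed.

Lemma eta_horizontal k : (forall b, (k == iz n b) = false) ->
  forall b, eta b p (D k) = 0.
Proof.
move=> kz b; have [A [_ -> _]] := eta_coord.
by rewrite dcoordinate_coord_vfield// kz mulr0.
Qed.

(* For horizontal [t] and [t'], the equality of [Phi 2 (., t')] and
   [Phi 1 (., t)] forces [phi 0 t = t'], hence [g (., t') = Phi 0 (., t)]. *)
Lemma metric_horizontal (e : R) k l s :
  (forall b, (k == iz n b) = false) -> (forall b, (l == iz n b) = false) ->
  (forall s, e * g p s (phi 2 p (D l)) = g p s (phi 1 p (D k))) ->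
  e * g p s (D l) = g p s (phi 0 p (D k)).
Proof.
move=> hk hl H; have := @phi_horizontal 2 p (D k) (e *: D l).
have -> : 2 + 2 = 1 :> 'I_3 by exact: val_inj.
have -> : 2 + 1 = 0 :> 'I_3 by exact: val_inj.
move=> ->; first by rewrite metricZr.
- exact: eta_horizontal.
- by move=> b; rewrite -[_ *: _]addr0 eta_linear eta_horizontal// mulr0 add0r eta0.
- by move=> s'; rewrite -[_ *: _]addr0 phi_linear phi0 addr0 metricZr.
Qed.

(** For horizontal [k], the differential [W k] is, up to sign, [Phi 0] against a partner field ([x]
    with [y], [u] with [v]), and [metric_horizontal] turns that value into [g(., D k)] with the same
    sign. *)
Lemma darboux_orthonormal k s : g p s (D k) = W k s.
Proof.
case: k / (darboux_indexP k) => [i|i|i|i|b].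
- apply: oppr_inj; rewrite -mulN1r; have [_ <- _ _] := Phi0_coord s i.
  apply: metric_horizontal => [b|b|s']; rewrite ?index_neqz//.
  have [_ H1 _ _] := Phi1_coord s' i; have [H2 _ _ _] := Phi2_coord s' i.
  exact: etrans (mulN1r _) (etrans (congr1 -%R H2) (esym H1)).
- rewrite -[LHS]mul1r; have [<- _ _ _] := Phi0_coord s i.
  apply: metric_horizontal => [b|b|s']; rewrite ?index_neqz//.
  have [H1 _ _ _] := Phi1_coord s' i; have [_ H2 _ _] := Phi2_coord s' i.
  exact: etrans (mul1r _) (etrans H2 (esym H1)).
- apply: oppr_inj; rewrite -mulN1r; have [_ _ _ <-] := Phi0_coord s i.
  apply: metric_horizontal => [b|b|s']; rewrite ?index_neqz//.
  have [_ _ _ H1] := Phi1_coord s' i; have [_ _ H2 _] := Phi2_coord s' i.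
  exact: etrans (mulN1r _) (etrans (congr1 -%R H2) (etrans (opprK _) (esym H1))).
- rewrite -[LHS]mul1r; have [_ _ <- _] := Phi0_coord s i.
  apply: metric_horizontal => [b|b|s']; rewrite ?index_neqz//.
  have [_ _ H1 _] := Phi1_coord s' i; have [_ _ _ H2] := Phi2_coord s' i.
  exact: etrans (mul1r _) (etrans H2 (esym H1)).
- have [A [A1 etaW etag]] := eta_coord.
  (* Multiplying by [A b * A (b + 1) = 1] makes [eta b] appear; in its other expression the
     remaining factor is [A (b + 1) * A (b + 2) = 1]. *)
  have := A1 (b + 2); rewrite !cyclicE => Abb.
  rewrite -[LHS]mul1r -Abb [A b * _]mulrC -mulrA -etag etaW mulrA.
  by rewrite A1 mul1r.
Qed.
End ThreeContact.

(** * Flatness *)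

Section Connection.
Context {R : realType} {m : nat} {M : smooth_manifold R m}.
Variable nabla : vfield M -> vfield M -> vfield M.
Hypothesis nabla_conn : is_connection nabla.
Implicit Types (U : set M) (X Y : vfield M) (f : M -> R) (p : M).

Lemma connection_smooth U X Y : open U -> smooth_vfield U X -> smooth_vfield U Y ->
  smooth_vfield U (nabla X Y).
Proof.
move=> oU sX sY.
by have [] := nabla_conn oU sX sX sY sY (smooth_fun_cst 0 oU).
Qed.

Lemma connectionDl U X X' Y p : open U -> U p -> smooth_vfield U X ->
  smooth_vfield U X' -> smooth_vfield U Y ->
  nabla (fun q => X q + X' q) Y p = nabla X Y p + nabla X' Y p.
Proof.
move=> oU Up sX sX' sY.
by have [_ /(_ p Up)[]] := nabla_conn oU sX sX' sY sY (smooth_fun_cst 0 oU).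
Qed.

Lemma connectionZl U X Y f p : open U -> U p -> smooth_vfield U X ->
  smooth_vfield U Y -> smooth_fun U f ->
  nabla (fun q => f q *: X q) Y p = f p *: nabla X Y p.
Proof.
by move=> oU Up sX sY sf; have [_ /(_ p Up)[]] := nabla_conn oU sX sX sY sY sf.
Qed.

Lemma connectionDr U X Y Y' p : open U -> U p -> smooth_vfield U X ->
  smooth_vfield U Y -> smooth_vfield U Y' ->
  nabla X (fun q => Y q + Y' q) p = nabla X Y p + nabla X Y' p.
Proof.
move=> oU Up sX sY sY'.
by have [_ /(_ p Up)[]] := nabla_conn oU sX sX sY sY' (smooth_fun_cst 0 oU).
Qed.

Lemma connectionZr U X Y f p : open U -> U p -> smooth_vfield U X ->
  smooth_vfield U Y -> smooth_fun U f ->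
  nabla X (fun q => f q *: Y q) p = vact X f p *: Y p + f p *: nabla X Y p.
Proof.
by move=> oU Up sX sY sf; have [_ /(_ p Up)[]] := nabla_conn oU sX sX sY sY sf.
Qed.

Lemma connection_suml U k (f : 'I_k -> M -> R) (X : 'I_k -> vfield M) Y p :
  open U -> U p -> (forall i, smooth_fun U (f i)) ->
  (forall i, smooth_vfield U (X i)) -> smooth_vfield U Y ->
  nabla (fun q => \sum_(i < k) f i q *: X i q) Y p =
  \sum_(i < k) f i p *: nabla (X i) Y p.
Proof.
move=> oU Up + + sY; elim: k f X => [|k IH] f X sf sX.
  rewrite big_ord0; under eq_fun do rewrite big_ord0.
  (* The empty sum is written as 0 times a smooth field to bring it under the Leibniz rules. *)
  rewrite (_ : (fun=> 0) = (fun q => (cst 0 : M -> R) q *: Y q)); last first.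
    by apply/funext => q; rewrite scale0r.
  by rewrite (connectionZl oU Up sY sY (smooth_fun_cst 0 oU)) scale0r.
rewrite big_ord_recr /=; under eq_fun do rewrite big_ord_recr /=.
rewrite (connectionDl oU Up _ _ sY).
- by rewrite (IH _ _ (fun i => sf _) (fun i => sX _)) (connectionZl oU Up (sX _) sY).
- exact: smooth_vfield_sum oU (fun i => smooth_vfieldZ oU (sX _) (sf _)).
- exact: smooth_vfieldZ oU (sX _) (sf _).
Qed.

Lemma connection_sumr U k (f : 'I_k -> M -> R) X (Y : 'I_k -> vfield M) p :
  open U -> U p -> (forall i, smooth_fun U (f i)) ->
  (forall i, smooth_vfield U (Y i)) -> smooth_vfield U X ->
  nabla X (fun q => \sum_(i < k) f i q *: Y i q) p =
  \sum_(i < k) (vact X (f i) p *: Y i p + f i p *: nabla X (Y i) p).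
Proof.
move=> oU Up + + sX; elim: k f Y => [|k IH] f Y sf sY.
  rewrite big_ord0; under eq_fun do rewrite big_ord0.
  rewrite (_ : (fun=> 0) = (fun q => (cst 0 : M -> R) q *: X q)); last first.
    by apply/funext => q; rewrite scale0r.
  rewrite (connectionZr oU Up sX sX (smooth_fun_cst 0 oU)).
  by rewrite /vact dfun_cst !scale0r addr0.
rewrite big_ord_recr /=; under eq_fun do rewrite big_ord_recr /=.
rewrite (connectionDr oU Up sX).
- by rewrite (IH _ _ (fun i => sf _) (fun i => sY _)) (connectionZr oU Up sX (sY _)).
- exact: smooth_vfield_sum oU (fun i => smooth_vfieldZ oU (sY _) (sf _)).
- exact: smooth_vfieldZ oU (sY _) (sf _).
Qed.

(* Multiplication by the indicator function of [U], which is smooth on [U],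
   makes fields that agree on [U] equal. *)
Lemma connection_local U X X' Y Y' p : open U -> U p ->
  smooth_vfield U X -> smooth_vfield U Y ->
  {in U, X =1 X'} -> {in U, Y =1 Y'} -> nabla X Y p = nabla X' Y' p.
Proof.
move=> oU Up sX sY XX' YY'.
have sX' := smooth_vfield_eq oU XX' sX; have sY' := smooth_vfield_eq oU YY' sY.
pose f q : R := \1_U q.
have f1 : {in U, cst 1 =1 f} by move=> q; rewrite /f indicE => ->.
have sf : smooth_fun U f := smooth_fun_eq oU f1 (smooth_fun_cst 1 oU).
have fp : f p = 1 by rewrite -f1// inE.
have ind (Z Z' : vfield M) : {in U, Z =1 Z'} ->
    (fun q => f q *: Z q) = (fun q => f q *: Z' q).
  move=> ZZ'; apply/funext => q; rewrite /f indicE.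
  by case: (boolP (q \in U)) => [/ZZ' ->//|_]; rewrite !scale0r.
have fl Z W : smooth_vfield U Z -> smooth_vfield U W ->
    nabla (fun q => f q *: Z q) W p = nabla Z W p.
  by move=> sZ sW; rewrite (connectionZl oU Up)// fp scale1r.
have fr Z W : smooth_vfield U Z -> smooth_vfield U W ->
    nabla Z (fun q => f q *: W q) p = nabla Z W p.
  move=> sZ sW; rewrite (connectionZr oU Up)// fp scale1r.
  by rewrite /vact -(dfun_eq _ oU Up f1) dfun_cst scale0r add0r.
by rewrite -(fl X Y)// (ind _ _ XX') fl// -(fr X' Y)// (ind _ _ YY') fr.
Qed.
End Connection.

(** * Connection and curvature in a chart with orthonormal coordinate fields *)

Section OrthonormalCoordinates.
Context {R : realType} {m : nat} {M : smooth_manifold R m}.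
Variables (g : form2 M) (nabla : vfield M -> vfield M -> vfield M).
Hypothesis gC : forall p v w, g p v w = g p w v.
Hypothesis lc : is_levi_civita g nabla.
Variable c : chart R m M.
Hypothesis ac : atlas c.
Hypothesis g_coord : forall p, chart_dom c p -> forall k s,
  g p s (coord_vfield c k p) = dfun (coordinate c k) p s.
Implicit Types (U : set M) (X Y Z : vfield M) (p : M).

Let nabla_conn : is_connection nabla := lc.1.
Let oc := chart_dom_open c.
Let sc i : smooth_fun (chart_dom c) (coordinate c i) := smooth_coordinate i ac.
Let sd i : smooth_vfield (chart_dom c) (coord_vfield c i) := smooth_coord_vfield i ac.

Lemma tangent_eq0 p v : chart_dom c p ->
  (forall k, dfun (coordinate c k) p v = 0) -> v = 0.
Proof.
move=> cp v0; rewrite (tangent_expand v ac cp); apply: big1 => k _.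
by rewrite v0 scale0r.
Qed.

Lemma dfun_lsum U f k (a : 'I_k -> R) (v : 'I_k -> 'rV[R]_m) p :
  open U -> U p -> smooth_fun U f ->
  dfun f p (\sum_(i < k) a i *: v i) = \sum_(i < k) a i * dfun f p (v i).
Proof.
move=> oU Up sf; elim: k a v => [|k IH] a v.
  by rewrite !big_ord0 (dfun_lin0 oU Up).
by rewrite !big_ord_recr /= addrC (dfun_linear _ _ _ oU Up sf) IH addrC.
Qed.

Lemma bracket_coord_vfield i j p : chart_dom c p ->
  bracket (coord_vfield c i) (coord_vfield c j) p = 0.
Proof.
move=> cp; apply: (tangent_eq0 cp) => k; rewrite (dfun_bracket oc)//.
have vact_cst l : {in chart_dom c, vact (coord_vfield c l) (coordinate c k) =1
    cst ((l == k)%:R : R)}.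
  by move=> q; rewrite inE => cq; rewrite /vact dcoordinate_coord_vfield.
have vact2 l l' :
    vact (coord_vfield c l) (vact (coord_vfield c l') (coordinate c k)) p = 0.
  by rewrite {1}/vact (dfun_eq _ oc cp (vact_cst l')) dfun_cst.
by rewrite (vact2 i j) (vact2 j i) subrr.
Qed.

(** The array [G] is symmetric in its first two indices, by zero torsion and commuting coordinate
    fields, and skew in the last two, because the metric has constant components. Such an array
    vanishes. *)
Lemma nabla_coord_vfield i j p : chart_dom c p ->
  nabla (coord_vfield c i) (coord_vfield c j) p = 0.
Proof.
move=> cp; have [_ LC] := lc.
pose G i j k :=
  g p (nabla (coord_vfield c i) (coord_vfield c j) p) (coord_vfield c k p).
have G_sym a b k : G a b k = G b a k.
  have [+ _] := LC _ _ _ _ oc (sd a) (sd b) (sd k) p cp.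
  by rewrite (bracket_coord_vfield a b cp) /G => /subr0_eq ->.
have G_anti a b k : G a b k = - G a k b.
  have [_] := LC _ _ _ _ oc (sd a) (sd b) (sd k) p cp.
  rewrite [X in _ = _ + X]gC -/(G a b k) -/(G a k b) /vact.
  have g_cst : {in chart_dom c,
      (fun q => g q (coord_vfield c b q) (coord_vfield c k q)) =1
      cst ((b == k)%:R : R)}.
    by move=> q; rewrite inE => cq; rewrite g_coord// dcoordinate_coord_vfield.
  by rewrite (dfun_eq _ oc cp g_cst) dfun_cst => /esym/eqP; rewrite addr_eq0 => /eqP.
apply: (tangent_eq0 cp) => k; rewrite -g_coord// -/(G i j k).
(* Three skew exchanges alternating with three symmetric ones return to the initial order with a
   minus sign. *)
have : G i j k = - G i j k.
  by rewrite {1}G_anti (G_sym i k) G_anti opprK (G_sym k j) G_anti (G_sym j i).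
by move/eqP; rewrite eq_sym eqNr => /eqP.
Qed.

Lemma vfield_expand U X : {in U `&` chart_dom c, X =1
  fun q => \sum_(k < m) vact X (coordinate c k) q *: coord_vfield c k q}.
Proof. by move=> q; rewrite inE => -[_ cq]; exact: tangent_expand. Qed.

(** The expansion of [X] and [Z] in coordinate fields holds only over the chart, so
    [connection_local] is needed to substitute it inside [nabla]; the Leibniz rule then leaves only
    the derivatives of the components of [Z]. *)
Lemma nabla_coord U X Z p : open U -> U p -> chart_dom c p ->
  smooth_vfield U X -> smooth_vfield U Z ->
  nabla X Z p =
  \sum_(k < m) vact X (vact Z (coordinate c k)) p *: coord_vfield c k p.
Proof.
move=> oU Up cp sX sZ.
have oUc : open (U `&` chart_dom c) by exact: openI.
have Ucp : (U `&` chart_dom c) p by [].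
have sX' := smooth_vfield_sub (@subIsetl _ U (chart_dom c)) sX.
have sZ' := smooth_vfield_sub (@subIsetl _ U (chart_dom c)) sZ.
have sd' i := smooth_vfield_sub (@subIsetr _ U (chart_dom c)) (sd i).
have nabla0 k : nabla X (coord_vfield c k) p = 0.
  rewrite (connection_local nabla_conn oUc Ucp sX' (sd' k)
    (@vfield_expand U X) (fun _ _ => erefl)).
  rewrite (connection_suml nabla_conn oUc Ucp _ sd' (sd' k)).
    by apply: big1 => i _; rewrite nabla_coord_vfield// scaler0.
  by move=> i; exact: sX.
rewrite (connection_local nabla_conn oUc Ucp sX' sZ'
  (fun _ _ => erefl) (@vfield_expand U Z)).
rewrite (connection_sumr nabla_conn oUc Ucp _ sd' sX').
  by apply: eq_bigr => k _; rewrite nabla0 scaler0 addr0.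
by move=> i; exact: sZ.
Qed.

Lemma curvature_coord U X Y Z p : open U -> U p -> chart_dom c p ->
  smooth_vfield U X -> smooth_vfield U Y -> smooth_vfield U Z ->
  curvature nabla X Y Z p = 0.
Proof.
move=> oU Up cp sX sY sZ.
have oUc : open (U `&` chart_dom c) by exact: openI.
have Ucp : (U `&` chart_dom c) p by [].
have vact_nabla V W k : smooth_vfield U V -> smooth_vfield U W ->
    {in U `&` chart_dom c, vact (nabla V W) (coordinate c k) =1
     vact V (vact W (coordinate c k))}.
  move=> sV sW q; rewrite inE => -[Uq cq].
  rewrite {1}/vact (nabla_coord oU Uq cq sV sW).
  rewrite (dfun_lsum _ _ oc cq (sc k)) (bigD1 k)//= big1 => [|i ik].
    by rewrite dcoordinate_coord_vfield// eqxx mulr1 addr0.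
  by rewrite dcoordinate_coord_vfield// (negbTE ik) mulr0.
have sXY := smooth_bracket oU sX sY.
have sYZ := connection_smooth nabla_conn oU sY sZ.
have sXZ := connection_smooth nabla_conn oU sX sZ.
rewrite /curvature !(nabla_coord oU Up cp)// -!sumrB big1// => k _.
rewrite -!scalerBl {1 3}/vact.
have sX' := smooth_vfield_sub (@subIsetl _ U (chart_dom c)) sX.
have sY' := smooth_vfield_sub (@subIsetl _ U (chart_dom c)) sY.
rewrite (dfun_eq _ oUc Ucp (vact_nabla Y Z k sY sZ)).
rewrite (dfun_eq _ oUc Ucp (vact_nabla X Z k sX sZ)).
rewrite -[vact (bracket X Y) _ p]/(dfun _ p (bracket X Y p)).
(* The function differentiated along the bracket is the component [vact Z (coordinate c k)], smooth
   on the intersection of [U] with the chart. *)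
rewrite (dfun_bracket oUc Ucp sX' sY' (sZ c ac k)).
by rewrite subrr scale0r.
Qed.
End OrthonormalCoordinates.

Theorem proposition4p5 (R : realType) (n : nat)
    (M : smooth_manifold R (4 * n).+3)
    (phi : 'I_3 -> endo M) (xi : 'I_3 -> vfield M) (eta : 'I_3 -> form1 M)
    (g : form2 M) :
  is_3cosymplectic phi xi eta g ->
  (forall p : M, exists c : chart R (4 * n).+3 M,
     [/\ atlas c, chart_dom c p,
         is_darboux (fun a => fundamental_form g (phi a)) xi c
       & has_standard_forms (fun a => fundamental_form g (phi a)) c]) ->
  is_flat g.
Proof.
move=> [h3 _] darboux nabla lc U X Y Z oU sX sY sZ p Up.
have [c [ac cp dc sc]] := darboux p.
apply: (curvature_coord (metricC h3) lc ac _ oU) => //.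
by move=> q cq k s; exact: (darboux_orthonormal h3 ac dc sc cq).
Qed.
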